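(* Let $\mathbb{F}$ be a finite field with $t$ elements and let $n,m\in\mathbb{N}$. Let $\phi=(\phi_1,\dots,\phi_n)$ be an $n$-tuple of non-increasing positive functions on $\mathbb{N}$ with $\phi_i(u)\to0$ as $u\to\infty$ ($1\le i\le n$), and let $\Phi=(\Phi_1,\dots,\Phi_m)$ be an $m$-tuple of non-decreasing positive functions on $\mathbb{N}$ with $\Phi_k(u)\to\infty$ as $u\to\infty$ ($1\le k\le m$). Assume there are constants $N_0,M\in\mathbb{N}_{>1}$ and $c_1,c_2>1$ such that $$c_1\Phi_k(M^j)\le\Phi_k(M^{j+1})\le c_2\Phi_k(M^j)\qquad(1\le k\le m,\ j\in\mathbb{N}_{\ge N_0}).$$ Then $$\mu^{\mathcal{L}}_{m\times n}\left(W^{\mathcal{L}}_{n,m}(\phi,\Phi)\right)=\begin{cases}0&\text{if }\sum_{r=1}^\infty\frac1r\prod_{k=1}^m\Phi_k(r)\prod_{i=1}^n\phi_i(r)<\infty,\\ 1&\text{if }\sum_{r=1}^\infty\frac1r\prod_{k=1}^m\Phi_k(r)\prod_{i=1}^n\phi_i(r)=\infty.\end{cases}$$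
   Context: $\mathcal{L}$ is the field of formal Laurent series $\sum_{i=-n}^\infty a_{-i}X^{-i}$ ($n\in\mathbb{Z}$, coefficients in $\mathbb{F}$, $a_n\ne0$) together with $0$, with absolute value $\left\|\sum_{i=-n}^\infty a_{-i}X^{-i}\right\|=t^n$ and $\|0\|=0$. For $x\in\mathcal{L}$, $|\langle x\rangle|=\min_{p\in\mathbb{F}[X]}\|x-p\|$. $I_{\mathcal{L}}=\{x\in\mathcal{L}:\|x\|<1\}$ and $I_{\mathcal{L}}^{m\times n}$ is the set of $m\times n$ matrices with entries in $I_{\mathcal{L}}$; $A_i$ is the $i$-th column of $A$. $\mu^{\mathcal{L}}_{m\times n}$ is Haar measure on $\mathcal{L}^{m\times n}$ normalised by $\mu^{\mathcal{L}}_{m\times n}(I_{\mathcal{L}}^{m\times n})=1$. $W^{\mathcal{L}}_{n,m}(\phi,\Phi)$ is the set of $A\in I_{\mathcal{L}}^{m\times n}$ such that for infinitely many $u\in\mathbb{N}$ the system $|\langle\mathbf qA_i\rangle|<\phi_i(u)$ ($1\le i\le n$), $\|q_k\|\le\Phi_k(u)$ ($1\le k\le m$) has a solution $\mathbf q=(q_1,\dots,q_m)\in\mathbb{F}[X]^m\setminus\{0\}$ (row vector). *)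

(* Defs.v *)
From HB Require Import structures.
From mathcomp Require Import all_boot all_order all_algebra.
From mathcomp Require Import zify.
From mathcomp Require Import all_classical all_reals all_analysis.

Set Implicit Arguments.
Unset Strict Implicit.
Unset Printing Implicit Defensive.

Import Order.TTheory GRing.Theory Num.Theory.
Import numFieldNormedType.Exports.

Local Open Scope classical_set_scope.
Local Open Scope ring_scope.

(* [lcoef x i] is the coefficient of X^i; only finitely many positive powers of
   X occur. The type [R] in which the absolute value below takes its values is
   a phantom parameter, so that the metric structure can be inferred from the
   type. *)
Record laurent (R : realType) (F : finFieldType) := Laurent {
  lcoef : int -> F;
  lcoef_bounded : exists n : int, forall i, n < i -> lcoef i = 0 }.

HB.instance Definition _ (R : realType) (F : finFieldType) :=
  gen_eqMixin (laurent R F).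
HB.instance Definition _ (R : realType) (F : finFieldType) :=
  gen_choiceMixin (laurent R F).

Section LaurentField.
Variables (R : realType) (F : finFieldType).
Local Notation L := (laurent R F).
Implicit Types x y z : L.

Definition above (f : int -> F) (n : int) := forall i, n < i -> f i = 0.

Lemma laurentP x y : lcoef x =1 lcoef y -> x = y.
Proof.
case: x y => [f hf] [g hg] /= /funext fg; subst g.
by congr Laurent; exact: Prop_irrelevance.
Qed.

Lemma above_le f a b : a <= b -> above f a -> above f b.
Proof. by move=> ab fa i bi; apply: fa; apply: le_lt_trans bi. Qed.

Lemma lzero_subproof : exists n, above (fun=> 0) n.
Proof. by exists 0. Qed.
Definition lzero : L := Laurent R lzero_subproof.

Lemma lone_subproof : exists n, above (fun i => (i == 0)%:R) n.
Proof. by exists 0 => i; case: eqVneq => // ->; rewrite ltxx. Qed.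
Definition lone : L := Laurent R lone_subproof.

Lemma lopp_subproof x : exists n, above (fun i => - lcoef x i) n.
Proof. by case: (lcoef_bounded x) => n xn; exists n => i /xn ->; rewrite oppr0. Qed.
Definition lopp x : L := Laurent R (lopp_subproof x).

Lemma ladd_subproof x y : exists n, above (fun i => lcoef x i + lcoef y i) n.
Proof.
have [a xa] := lcoef_bounded x; have [b yb] := lcoef_bounded y.
by exists (Num.max a b) => i; rewrite gt_max => /andP[/xa -> /yb ->]; rewrite addr0.
Qed.
Definition ladd x y : L := Laurent R (ladd_subproof x y).

(* Finitely many terms are nonzero when f and g vanish above some index, so
   this is the Cauchy product. *)
Definition conv (f g : int -> F) (k : int) : F :=
  \sum_(i \in [set: int]) f i * g (k - i).

Lemma conv_above f g a b : above f a -> above g b -> above (conv f g) (a + b).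
Proof.
move=> fa gb k abk; rewrite /conv fsbig1// => i _.
have [/fa ->|ia] := ltP a i; first by rewrite mul0r.
by rewrite (gb (k - i)) ?mulr0//; lia.
Qed.

Lemma convE f g a b (j : nat) : above f a -> above g b ->
  conv f g (a + b - j%:Z) =
  \sum_(i < j.+1) f (a - i%:Z) * g (b - (j - i)%N%:Z).
Proof.
move=> fa gb; rewrite /conv.
pose G (k : int) := f k * g (a + b - j%:Z - k).
pose h (i : nat) := a - i%:Z.
have -> : \sum_(i < j.+1) f (a - i%:Z) * g (b - (j - i)%N%:Z) =
    \sum_(i < j.+1) G (h i).
  apply: eq_bigr => i _; rewrite /G /h; congr (_ * g _).
  by have := ltn_ord i; lia.
rewrite (@fsbig_ord _ _ _ j.+1 (fun i => G (h i))).
rewrite -(fsbig_image `I_j.+1 h G); last by move=> i k _ _ /=; rewrite /h; lia.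
apply/esym/fsbig_widen => //= k [_ hk].
have [/fa fk|ka] := ltP a k; first by rewrite /= /G fk mul0r.
rewrite /= /G (gb (a + b - j%:Z - k)) ?mulr0//.
rewrite ltNge; apply/negP => kb; apply: hk; exists `|a - k|%N => /=; rewrite /h; lia.
Qed.

Lemma lmul_subproof x y : exists n, above (conv (lcoef x) (lcoef y)) n.
Proof.
have [a xa] := lcoef_bounded x; have [b yb] := lcoef_bounded y.
by exists (a + b); apply: conv_above.
Qed.
Definition lmul x y : L := Laurent R (lmul_subproof x y).

Let pol N (f : int -> F) a : {poly F} := \poly_(i < N) f (a - i%:Z).

Let conv_pol N f g a b (j : nat) : above f a -> above g b -> (j < N)%N ->
  conv f g (a + b - j%:Z) = (pol N f a * pol N g b)`_j.
Proof.
move=> fa gb jN; rewrite (convE _ fa gb) coefM; apply: eq_bigr => i _.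
have := ltn_ord i; rewrite ltnS => ij.
by rewrite !coef_poly (leq_ltn_trans ij jN) (leq_ltn_trans (leq_subr _ _) jN).
Qed.

Let coefM_trunc N (p q r : {poly F}) (j : nat) : (j < N)%N ->
  (forall i, (i < N)%N -> q`_i = r`_i) -> (p * q)`_j = (p * r)`_j.
Proof.
by move=> jN qr; rewrite !coefM; apply: eq_bigr => i _; rewrite qr// (leq_ltn_trans (leq_subr _ _) jN).
Qed.

Lemma laddA : associative ladd.
Proof. by move=> x y z; apply: laurentP => i /=; rewrite addrA. Qed.
Lemma laddC : commutative ladd.
Proof. by move=> x y; apply: laurentP => i /=; rewrite addrC. Qed.
Lemma ladd0 : left_id lzero ladd.
Proof. by move=> x; apply: laurentP => i /=; rewrite add0r. Qed.
Lemma laddN : left_inverse lzero lopp ladd.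
Proof. by move=> x; apply: laurentP => i /=; rewrite addNr. Qed.

Let int_case (c k : int) : (c < k) \/ exists j : nat, k = c - j%:Z.
Proof. by have [|] := ltP c k; [left|right; exists `|c - k|%N; lia]. Qed.

Lemma lmulC : commutative lmul.
Proof.
move=> x y; apply: laurentP => k /=.
have [a xa] := lcoef_bounded x; have [b yb] := lcoef_bounded y.
have [abk|[j ->]] := int_case (a + b) k.
  by rewrite (conv_above xa yb abk) (conv_above yb xa)// addrC.
rewrite (conv_pol xa yb (ltnSn j)) mulrC -(conv_pol yb xa (ltnSn j)).
by rewrite (addrC b).
Qed.

Lemma lmulA : associative lmul.
Proof.
move=> x y z; apply: laurentP => k /=.
have [a xa] := lcoef_bounded x; have [b yb] := lcoef_bounded y.
have [c zc] := lcoef_bounded z.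
have xyab := conv_above xa yb; have yzbc := conv_above yb zc.
have [abk|[j ->]] := int_case (a + b + c) k.
  rewrite (conv_above xyab zc)// (conv_above xa yzbc)//; lia.
rewrite (conv_pol xyab zc (ltnSn j)) -(addrA a b c) (conv_pol xa yzbc (ltnSn j)).
rewrite (@coefM_trunc j.+1 _ _ (pol j.+1 (lcoef y) b * pol j.+1 (lcoef z) c))//.
  rewrite mulrA (mulrC (pol _ (conv _ _) _)) (mulrC (pol _ _ _ * pol _ _ _)).
  apply: (@coefM_trunc j.+1) => // i ij.
  by rewrite [RHS]coef_poly ij (conv_pol xa yb ij).
by move=> i ij; rewrite [LHS]coef_poly ij (conv_pol yb zc ij).
Qed.

Lemma lmul1 : left_id lone lmul.
Proof.
move=> x; apply: laurentP => k /=; rewrite /conv.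
rewrite -(@fsbig_widen _ _ _ _ [set (0 : int)]) //; last first.
  by move=> i [_ /eqP /= /negbTE ->]; rewrite mul0r.
by rewrite fsbig_set1 eqxx mul1r subr0.
Qed.

Lemma lmulDl : left_distributive lmul ladd.
Proof.
move=> x y z; apply: laurentP => k /=.
have [a xa] := lcoef_bounded x; have [b yb] := lcoef_bounded y.
have [c zc] := lcoef_bounded z.
pose d := Num.max a b.
have {}xa : above (lcoef x) d by apply: above_le xa; rewrite le_max lexx.
have {}yb : above (lcoef y) d by apply: above_le yb; rewrite le_max lexx orbT.
have xyd : above (fun i => lcoef x i + lcoef y i) d.
  by move=> i di; rewrite xa// yb// addr0.
have [dk|[j ->]] := int_case (d + c) k.
  by rewrite !(conv_above _ zc dk)// addr0.
rewrite !(convE _ _ zc)// -big_split; apply: eq_bigr => i _ /=.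
by rewrite mulrDl.
Qed.

Lemma lone_neq0 : lone != lzero.
Proof.
by apply/eqP => /(congr1 (fun x => lcoef x 0)) /= /eqP; rewrite oner_eq0.
Qed.

End LaurentField.

HB.instance Definition _ (R : realType) (F : finFieldType) :=
  GRing.isZmodule.Build (laurent R F)
    (@laddA R F) (@laddC R F) (@ladd0 R F) (@laddN R F).
HB.instance Definition _ (R : realType) (F : finFieldType) :=
  GRing.Zmodule_isComNzRing.Build (laurent R F)
    (@lmulA R F) (@lmulC R F) (@lmul1 R F) (@lmulDl R F) (@lone_neq0 R F).
HB.instance Definition _ (R : realType) (F : finFieldType) :=
  isPointed.Build (laurent R F) 0.

Section LaurentInverse.
Variables (R : realType) (F : finFieldType).
Local Notation L := (laurent R F).
Implicit Types x y z : L.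

Definition is_ldeg x (n : int) :=
  lcoef x n != 0 /\ forall i, n < i -> lcoef x i = 0.

Lemma is_ldeg_ex x : x != 0 -> exists n, is_ldeg x n.
Proof.
move=> x0; have [a xa] := lcoef_bounded x.
have /ex_minnP[j xj minj] : exists j : nat, lcoef x (a - j%:Z) != 0.
  apply: contrapT => H; move/eqP: x0; apply; apply: laurentP => i /=.
  have [/xa//|ia] := ltP a i.
  apply/eqP; apply: contra_notT H => xi; exists `|a - i|%N.
  by rewrite (_ : a - _ = i)//; lia.
exists (a - j%:Z); split=> // i ji.
have [/xa//|ia] := ltP a i.
apply/eqP; apply: contraT => xi.
have := minj `|a - i|%N; rewrite (_ : a - _ = i) => [/(_ xi)|]; lia.
Qed.

Fixpoint inv_seq (p : nat -> F) (n : nat) : seq F :=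
  if n is k.+1 then
    let s := inv_seq p k in
    rcons s (((k == 0)%:R - \sum_(i < k) s`_i * p (k - i)%N) / p 0%N)
  else [::].

Lemma size_inv_seq p n : size (inv_seq p n) = n.
Proof. by elim: n => //= n IH; rewrite size_rcons IH. Qed.

Lemma nth_inv_seq p n i : (i < n)%N -> (inv_seq p n)`_i = (inv_seq p i.+1)`_i.
Proof.
elim: n => // n IH; rewrite ltnS leq_eqVlt => /orP[/eqP ->//|iN].
by rewrite [in LHS]/= nth_rcons size_inv_seq iN IH.
Qed.

Lemma inv_seqP p k : p 0%N != 0 ->
  \sum_(i < k.+1) (inv_seq p i.+1)`_i * p (k - i)%N = (k == 0)%:R.
Proof.
move=> p0; rewrite big_ord_recr subnn /= nth_rcons size_inv_seq ltnn eqxx.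
rewrite divfK// (eq_bigr (fun i : 'I_k => (inv_seq p k)`_i * p (k - i)%N)).
  by rewrite addrC subrK.
by move=> i _; rewrite (nth_inv_seq _ (ltn_ord i)).
Qed.

Lemma linv_ex x : x != 0 -> exists y, y * x = 1.
Proof.
move=> /is_ldeg_ex[n [xn xa]].
pose p i := lcoef x (n - i%:Z).
pose g (k : int) : F :=
  if k <= - n then (inv_seq p (absz (- n - k)%R).+1)`_(absz (- n - k)%R) else 0.
have ga : above g (- n) by move=> i; rewrite ltNge /g => /negbTE ->.
exists (Laurent R (ex_intro _ _ ga)); apply: laurentP => k.
change (conv g (lcoef x) k = (k == 0)%:R).
have [k0|k0] := ltP 0 k.
  rewrite (conv_above ga xa) ?addNr//.
  by case: eqVneq k0 => // ->; rewrite ltxx.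
rewrite (_ : k = - n + n - `|k|%N%:Z); last lia.
rewrite (convE _ ga xa) (_ : _ == 0 = (`|k|%N == 0)); last lia.
rewrite -(@inv_seqP p); last by rewrite /p subr0.
apply: eq_bigr => i _; congr (_ * _).
rewrite /g ifT; last lia.
by rewrite (_ : absz (- n - (- n - i%:Z))%R = i)//; lia.
Qed.

Definition linv x : L :=
  if x == 0 then 0 else xget 0 [set y | y * x = 1].

Lemma lmulVx x : x != 0 -> linv x * x = 1.
Proof.
move=> x0; rewrite /linv (negbTE x0).
by have [y yx] := linv_ex x0; have := xgetPex (0 : L) (ex_intro [set y | y * x = 1] y yx).
Qed.

Lemma linv0 : linv 0 = 0.
Proof. by rewrite /linv eqxx. Qed.

End LaurentInverse.

HB.instance Definition _ (R : realType) (F : finFieldType) :=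
  GRing.ComNzRing_isField.Build (laurent R F) (@lmulVx R F) (@linv0 R F).

Section LaurentNorm.
Variables (R : realType) (F : finFieldType).
Local Notation L := (laurent R F).
Implicit Types x y z : L.

Definition ldeg x : int := xget 0 (is_ldeg x).

Definition lnorm x : R :=
  if x == 0 then 0 else (#|F|%:R : R) ^ ldeg x.

Lemma ldegP x : x != 0 -> is_ldeg x (ldeg x).
Proof. by move=> /is_ldeg_ex[n xn]; apply: (xgetPex 0); exists n. Qed.

Lemma card_gt1 : 1 < (#|F|%:R : R).
Proof. by rewrite ltr1n card_finNzRing_gt1. Qed.

Lemma lnorm0 : lnorm 0 = 0.
Proof. by rewrite /lnorm eqxx. Qed.

Lemma lnorm_gt0 x : x != 0 -> 0 < lnorm x.
Proof.
move=> x0; rewrite /lnorm (negbTE x0) exprz_gt0//.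
exact: lt_trans card_gt1.
Qed.

Lemma lnorm_ge0 x : 0 <= lnorm x.
Proof. by have [->|/lnorm_gt0/ltW//] := eqVneq x 0; rewrite lnorm0. Qed.

Lemma lnorm_leP x (n : int) :
  lnorm x <= (#|F|%:R : R) ^ n <-> forall i, n < i -> lcoef x i = 0.
Proof.
have [->|x0] := eqVneq x 0.
  by rewrite lnorm0; split=> // _; rewrite exprz_ge0.
have [xd dx] := ldegP x0.
rewrite /lnorm (negbTE x0) ler_eXz2l ?card_gt1//; split=> [dn i ni|H].
  by apply: dx; apply: le_lt_trans ni.
by rewrite leNgt; apply/negP => /H /eqP; apply/negP.
Qed.

Lemma lnormN x : lnorm (- x) = lnorm x.
Proof.
rewrite /lnorm oppr_eq0; case: eqVneq => // _; congr (_ ^ xget _ _).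
apply/seteqP; split=> n [/= xn H]; (split=> [|i /H /= h]; [by move: xn; rewrite /= oppr_eq0|]).
  by apply/eqP; rewrite -oppr_eq0; apply/eqP.
by rewrite h oppr0.
Qed.

Lemma lnorm_ultra x y : lnorm (x + y) <= Num.max (lnorm x) (lnorm y).
Proof.
have [->|x0] := eqVneq x 0; first by rewrite add0r le_max lexx orbT.
have [->|y0] := eqVneq y 0; first by rewrite addr0 le_max lexx.
rewrite {2 3}/lnorm (negbTE x0) (negbTE y0).
have [_ dx] := ldegP x0; have [_ dy] := ldegP y0.
have t1 := card_gt1.
have -> : Num.max ((#|F|%:R : R) ^ ldeg x) (#|F|%:R ^ ldeg y) =
    #|F|%:R ^ Num.max (ldeg x) (ldeg y).
  have [xy|/ltW yx] := leP (ldeg x) (ldeg y).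
    by rewrite max_r// ler_eXz2l.
  by rewrite max_l// ler_eXz2l.
apply/lnorm_leP => i; rewrite gt_max => /andP[xi yi].
by rewrite /= dx// dy// addr0.
Qed.

Definition ldist x y : R := lnorm (x - y).

Lemma ldistxx x : ldist x x = 0.
Proof. by rewrite /ldist subrr lnorm0. Qed.

Lemma ldist_eq0 x y : ldist x y = 0 -> x = y.
Proof.
move=> xy; apply/eqP; rewrite -subr_eq0; apply: contraPT xy => /lnorm_gt0.
by rewrite lt0r => /andP[/eqP].
Qed.

Lemma ldist_sym x y : ldist x y = ldist y x.
Proof. by rewrite /ldist -lnormN opprB. Qed.

Lemma ldist_triangle y x z : ldist x z <= ldist x y + ldist y z.
Proof.
rewrite /ldist (_ : x - z = (x - y) + (y - z)); last by rewrite addrA subrK.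
by rewrite (le_trans (lnorm_ultra _ _))// ge_max lerDl lerDr !lnorm_ge0.
Qed.

End LaurentNorm.

HB.instance Definition _ (R : realType) (F : finFieldType) :=
  isMetric.Build R (laurent R F) (@ldistxx R F) (@ldist_eq0 R F)
    (@ldist_sym R F) (@ldist_triangle R F).

Section PolynomialPart.
Variables (R : realType) (F : finFieldType).
Local Notation L := (laurent R F).

Lemma lpoly_subproof (p : {poly F}) : exists n : int, forall i, n < i ->
  (if i is Posz k then p`_k else 0) = 0.
Proof.
exists (size p) => -[k|//] pk; rewrite nth_default//.
by move: pk; rewrite ltz_nat => /ltnW.
Qed.
Definition lpoly (p : {poly F}) : L := Laurent R (lpoly_subproof p).

(* The infimum is a minimum by [dist_poly_min]. *)
Definition dist_poly (x : L) : R :=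
  inf [set lnorm (x - lpoly p) | p in [set: {poly F}]].

Lemma dist_poly_min (x : L) : exists2 p : {poly F},
  dist_poly x = lnorm (x - lpoly p) &
  forall q : {poly F}, lnorm (x - lpoly p) <= lnorm (x - lpoly q).
Proof.
have [a xa] := lcoef_bounded x.
pose p : {poly F} := \poly_(i < `|a|.+1) lcoef x i%:Z.
have minp q : lnorm (x - lpoly p) <= lnorm (x - lpoly q).
  have [|y0] := eqVneq (x - lpoly p) 0; first by move->; rewrite lnorm0 lnorm_ge0.
  have pk (k : nat) : lcoef (x - lpoly p) k = 0.
    rewrite /= coef_poly; case: ltnP => [_|ka]; first by rewrite subrr.
    by rewrite xa ?subrr//; lia.
  have [yd dy] := ldegP y0.
  case E : (ldeg (x - lpoly p)) => [k|k]; first by move: yd; rewrite E pk eqxx.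
  have Eq : lcoef (x - lpoly q) (Negz k) != 0 by move: yd; rewrite E.
  have [z0|z0] := eqVneq (x - lpoly q) 0; first by move: Eq; rewrite z0 eqxx.
  rewrite leNgt; apply/negP => H.
  have : lnorm (x - lpoly q) <= (#|F|%:R : R) ^ (Negz k - 1).
    move: H; rewrite /lnorm (negbTE y0) (negbTE z0) E.
    rewrite ltr_eXz2l ?card_gt1// ler_eXz2l ?card_gt1//.
    by move: (ldeg _) => d; lia.
  move=> /lnorm_leP /(_ (Negz k)) H'; move: Eq; rewrite H' ?eqxx//.
  by rewrite ltrBlDr ltrDl.
exists p => //; apply/eqP; rewrite eq_le; apply/andP; split.
  apply: ge_inf; last by exists p.
  by exists 0 => _ [q _ <-]; exact: lnorm_ge0.
apply: lb_le_inf; first by exists (lnorm (x - lpoly p)); exists p.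
by move=> _ [q _ <-].
Qed.

End PolynomialPart.

Section HaarMeasure.
Variables (R : realType) (F : finFieldType) (m n : nat).
Local Notation L := (laurent R F).

(* The Borel sets of the metric space of matrices (sup distance). *)
Definition lmx_borel := g_sigma_algebraType (@open 'M[L]_(m, n)).

(* Regularity need not be required: matrices over [L] form a second countable
   locally compact space. *)
Record haar_measure (mu : {measure set lmx_borel -> \bar R}) : Prop := {
  haar_translation : forall (A : 'M[L]_(m, n)) (E : set 'M[L]_(m, n)),
    measurable (E : set lmx_borel) ->
    mu [set A + B | B in E] = mu E;
  haar_compact : forall K : set 'M[L]_(m, n), compact K -> (mu K < +oo)%E;
  haar_open : forall U : set 'M[L]_(m, n), open U -> U !=set0 -> (0 < mu U)%E }.

Definition lunit_mx : set 'M[L]_(m, n) :=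
  [set A | forall i j, lnorm (A i j) < 1].

(* Functions on the positive integers are functions on [nat] whose value at 0
   is never used. *)
Definition W_set (phi : 'I_n -> nat -> R) (Phi : 'I_m -> nat -> R) :
    set 'M[L]_(m, n) :=
  [set A | lunit_mx A /\
    infinite_set [set u : nat | (0 < u)%N /\
      exists q : 'rV[{poly F}]_m,
        [/\ q != 0,
            forall i : 'I_n,
              dist_poly ((map_mx (@lpoly R F) q *m col i A) 0 0) < phi i u &
            forall k : 'I_m, lnorm (@lpoly R F (q 0 k)) <= Phi k u]]].

End HaarMeasure.

(* Main.v *)
Require Import Defs.
From HB Require Import structures.
From mathcomp Require Import all_boot all_order all_algebra.
From mathcomp Require Import zify lra.
From mathcomp Require Import all_classical all_reals all_analysis.

Set Implicit Arguments.
Unset Strict Implicit.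
Unset Printing Implicit Defensive.

Import Order.TTheory GRing.Theory Num.Theory.
Import numFieldNormedType.Exports.

Local Open Scope classical_set_scope.
Local Open Scope ring_scope.

(** Call a vector [q] of polynomials a solution for [A] at given degree bounds
    and given lengths [l_i] if [q] is nonzero, obeys the bounds, and the first
    [l_i] fractional digits of [q A_i] vanish for every [i]. Both families of
    real thresholds take effect only through integers: [|q_k| <= Phi_k(u)]
    bounds the size of [q_k] by some [D_k(u)], and [|<q A_i>| < phi_i(u)] says
    that the first [l_i(u)] fractional digits vanish. Up to constants
    [prod_k Phi_k prod_i phi_i] is [t^(C - r)], with [C] the sum of the [D_k]
    and [r] the sum of the [l_i]; and for one nonzero [q], [r] digit
    constraints hold with probability exactly [t^-r] ([prob_vanishes_nz]). So
    [t^(C - r)] bounds the probability of solvability ([prob_box]). Along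
    [u = M^j] the growth condition makes the sum of these bounds comparable
    with the given series, and the convergent case is the Borel-Cantelli lemma
    ([mu_W_convergent]).

    In the divergent case it is enough to hit solutions often enough along a
    sparse sequence [u_0 < u_1 < ...] on which every degree bound grows by more
    than [w] from one stage to the next. The idea is to construct the solution
    candidate of each stage from few digits of [A] and to test it on fresh
    ones. Three choices make the stages interact in an exactly computable way.

    - All constraints [(i, s)], that is, digit [s] of [q A_i] is zero, are put
      in one linear order such that the constraints required at each stage form
      an initial segment ([row_order]). This is possible because the [l_i] are
      monotone in [u].

    - At a stage with [C] degrees of freedom, look at the first [r = C + w]
      constraints. With probability at least [1 - t^-w] no nonzero vector in
      the box satisfies them all. If so, allow [w + 1] more degrees in one
      coordinate [k0]: by pigeonhole there are now vectors satisfying the [r]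
      constraints, and among them there is exactly one that is monic and of
      minimal degree in that coordinate ([minimal_vector_ex],
      [minimal_vector_uniq]). The top coefficient of its [k0]-th coordinate
      brings into each later constraint a digit of [A] that has not been
      looked at, so that, given everything before, the candidate passes the
      remaining constraints of the stage with probability exactly [t^-(number
      of remaining constraints)] ([prob_vanishes]).

    - Earlier stages do not spoil this. If the constraints of an earlier stage
      are among the first [r] ones, success at that stage has already been
      decided. Otherwise success would give a vector that satisfies the first
      [r] constraints and has degree too small for a minimal vector to exist
      now ([no_hit_shift]).

    Hence the probability [z_i] of no success before stage [i] satisfies
    [z_(i+1) <= z_i - p_i (z_i - t^-w)], where the sum of the [p_i] diverges
    with the series; so [z_i] falls below [2 t^-w] ([prob_no_hit]). As [w] is
    arbitrary, almost every [A] has infinitely many solutions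
    ([mu_W_divergent]). *)

(** * Fractional digits of linear forms *)

Section FractionalDigits.
Variables (R : realType) (F : finFieldType) (m n : nat).
Local Notation L := (laurent R F).
Local Notation Q := 'rV[{poly F}]_m.
Local Notation MX := 'M[L]_(m, n).
Implicit Types (q : Q) (A B : MX) (i : 'I_n) (k : 'I_m).

Lemma lcoef_lpolyM (p : {poly F}) (x : L) (N : nat) (j : int) :
  (size p <= N)%N ->
  lcoef (@lpoly R F p * x) j = \sum_(e < N) p`_e * lcoef x (j - e%:Z).
Proof.
move=> pN; rewrite [LHS]/= /conv.
rewrite (@fsbig_ord _ _ _ N (fun e : nat => p`_e * lcoef x (j - e%:Z))).
rewrite -(fsbig_image `I_N Posz
   (fun i : int => (if i is Posz k then p`_k else 0) * lcoef x (j - i))).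
  apply/esym/fsbig_widen => // -[e|e] [_ he] /=; last by rewrite mul0r.
  rewrite nth_default ?mul0r// (leq_trans pN)// leqNgt.
  by apply/negP => eN; apply: he; exists e.
by move=> a b _ _ [].
Qed.

(** Digits are counted from [s = 0], the coefficient of [X^-1]. *)
Definition frac_digit q A i (s : nat) : F :=
  lcoef ((map_mx (@lpoly R F) q *m col i A) 0 0) (- s.+1%:Z).

Lemma lcoef_sum (I : Type) (r : seq I) (f : I -> L) (j : int) :
  lcoef (\sum_(a <- r) f a) j = \sum_(a <- r) lcoef (f a) j.
Proof. by elim/big_ind2 : _ => // x a y b <- <-. Qed.

Lemma frac_digitE q A i s N : (forall k, size (q 0%R k) <= N)%N ->
  frac_digit q A i s =
  \sum_k \sum_(e < N) (q 0 k)`_e * lcoef (A k i) (- (s + e).+1%:Z).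
Proof.
move=> qN; rewrite /frac_digit mxE lcoef_sum; apply: eq_bigr => k _.
rewrite !mxE (lcoef_lpolyM _ _ (qN k)); apply: eq_bigr => e _.
by congr (_ * lcoef _ _); lia.
Qed.

Definition row_size q : nat := \max_k size (q 0%R k).

Lemma size_row q k : (size (q 0%R k) <= row_size q)%N.
Proof. exact: (leq_bigmax k). Qed.

Lemma frac_digitD q A B i s :
  frac_digit q (A + B) i s = frac_digit q A i s + frac_digit q B i s.
Proof.
rewrite !(frac_digitE _ _ _ (size_row q)) -big_split; apply: eq_bigr => k _.
rewrite -big_split; apply: eq_bigr => e _ /=; rewrite mxE /= mulrDr //.
Qed.

Lemma frac_digitBl q q' A i s :
  frac_digit (q - q') A i s = frac_digit q A i s - frac_digit q' A i s.
Proof.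
pose N := maxn (row_size q) (row_size q').
have qN k : (size (q 0%R k) <= N)%N by rewrite leq_max size_row.
have qN' k : (size (q' 0%R k) <= N)%N by rewrite leq_max size_row orbT.
have dN k : (size ((q - q')%R 0%R k) <= N)%N.
  by rewrite !mxE (leq_trans (size_polyD _ _))// size_polyN geq_max qN qN'.
rewrite (frac_digitE _ _ _ qN) (frac_digitE _ _ _ qN') (frac_digitE _ _ _ dN).
rewrite -sumrB; apply: eq_bigr => k _; rewrite -sumrB; apply: eq_bigr => e _.
by rewrite !mxE coefB mulrBl.
Qed.

Lemma frac_digitZl (c : F) q A i s :
  frac_digit (c%:P *: q) A i s = c * frac_digit q A i s.
Proof.
have dN k : (size ((c%:P *: q)%R 0%R k) <= row_size q)%N.
  by rewrite !mxE mul_polyC (leq_trans (size_scale_leq _ _))// size_row.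
rewrite (frac_digitE _ _ _ (size_row q)) (frac_digitE _ _ _ dN).
rewrite mulr_sumr; apply: eq_bigr => k _; rewrite mulr_sumr.
by apply: eq_bigr => e _; rewrite !mxE coefCM mulrA.
Qed.

Lemma lmono_subproof (c : F) (d : int) :
  exists a : int, forall j : int, a < j -> (if j == d then c else 0) = 0.
Proof. by exists d => j; case: eqVneq => // ->; rewrite ltxx. Qed.

Definition lmono (c : F) (d : int) : L := Laurent R (lmono_subproof c d).

Definition digit_mx k i (s : nat) (c : F) : MX :=
  \matrix_(k', i') if (k' == k) && (i' == i) then lmono c (- s.+1%:Z) else 0.

Lemma frac_digit_mx q k i i' (s s' : nat) (c : F) :
  frac_digit q (digit_mx k i' s' c) i s =
  if (i == i') && (s <= s')%N then (q 0 k)`_(s' - s) * c else 0.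
Proof.
rewrite (frac_digitE _ _ _ (size_row q)) (bigD1 k)//= [X in _ + X]big1 ?addr0; last first.
  by move=> k' /negbTE kk; rewrite big1// => e _; rewrite mxE kk /= mulr0.
case: eqVneq => [->|ii] /=; last first.
  by rewrite big1// => e _; rewrite mxE eqxx (negbTE ii) /= mulr0.
have E (e : nat) : lcoef (digit_mx k i' s' c k i') (- (s + e).+1%:Z) =
    if (s + e == s')%N then c else 0.
  by rewrite mxE !eqxx /= (_ : _ == _ :> int = (s + e == s')%N)//; lia.
under eq_bigr do rewrite E.
case: leqP => ss; last first.
  by rewrite big1// => e _; case: eqVneq => [?|_]; [lia|rewrite mulr0].
have [sN|sN] := ltnP (s' - s) (row_size q).
  rewrite (bigD1 (Ordinal sN))//= subnKC// eqxx big1 ?addr0// => e.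
  move=> /eqP es; case: eqVneq => [ee|_]; last by rewrite mulr0.
  by case: es; apply: val_inj => /=; lia.
rewrite nth_default ?mul0r; last by rewrite (leq_trans (size_row q k)).
rewrite big1// => e _; case: eqVneq => [ee|_]; last by rewrite mulr0.
by have := ltn_ord e; lia.
Qed.

End FractionalDigits.

(** * Borel sets and Haar probability on the unit matrices *)

Section BorelSets.
Variables (R : realType) (F : finFieldType) (m n : nat).
Local Notation L := (laurent R F).
Local Notation Q := 'rV[{poly F}]_m.
Local Notation MX := 'M[L]_(m, n).
Implicit Types (S : set MX) (A B : MX).

Lemma lnorm_ltP (x : L) (d : int) :
  lnorm x < (#|F|%:R : R) ^ d <-> forall j, d <= j -> lcoef x j = 0.
Proof.
have -> : (lnorm x < (#|F|%:R : R) ^ d) = (lnorm x <= (#|F|%:R : R) ^ (d - 1)).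
  have [->|x0] := eqVneq x 0.
    by rewrite lnorm0 exprz_ge0// exprz_gt0// (lt_trans _ (card_gt1 R F)).
  rewrite /lnorm (negbTE x0) ltr_eXz2l ?card_gt1// ler_eXz2l ?card_gt1//.
  by move: (ldeg x) => a; lia.
by rewrite lnorm_leP; split => H j jd; apply: H; lia.
Qed.

(** Balls around [A] consist of the matrices sharing finitely many leading
    digits with [A], so whatever is decided by finitely many digits is open. *)
Lemma open_digits S :
  (forall A, S A -> exists d : int, forall B : MX,
     (forall k i (j : int), d <= j -> lcoef (A k i) j = lcoef (B k i) j) ->
     S B) -> open S.
Proof.
move=> H; rewrite openE => A /H[d HB].
apply/nbhs_ballP; exists ((#|F|%:R : R) ^ d) => /=.
  by rewrite exprz_gt0// (lt_trans _ (card_gt1 R F)).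
move=> B [_ AB]; apply: HB => k i j dj; have := AB k i.
rewrite ballEmdist /= => /lnorm_ltP/(_ j dj)/= /eqP.
by rewrite subr_eq0 => /eqP.
Qed.

Definition borel S := measurable (S : set (lmx_borel R F m n)).

Lemma open_borel S : open S -> borel S.
Proof. exact: sub_gen_smallest. Qed.

Lemma borel_not S : borel S -> borel [set A | ~ S A].
Proof. exact: measurableC. Qed.

Lemma borel_and S S' : borel S -> borel S' -> borel [set A | S A /\ S' A].
Proof. exact: measurableI. Qed.

Lemma borel_or S S' : borel S -> borel S' -> borel [set A | S A \/ S' A].
Proof. exact: measurableU. Qed.

Lemma borel_cst (p : Prop) : borel [set _ | p].
Proof.
have [pT|pF] := pselect p.
  by rewrite (_ : [set _ | _] = setT); [exact: measurableT|apply/seteqP; split].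
rewrite (_ : [set _ | _] = set0); first exact: measurable0.
by apply/seteqP; split.
Qed.

Lemma borel_ex (T : countType) (G : T -> set MX) :
  (forall x, borel (G x)) -> borel [set A | exists x, G x A].
Proof.
move=> mG; rewrite (_ : [set A | _] = \bigcup_x G x).
  exact: (@countable_bigcupT_measurable _ (lmx_borel R F m n)).
by apply/seteqP; split => A /= [x]; exists x.
Qed.

Lemma borel_all (T : countType) (G : T -> set MX) :
  (forall x, borel (G x)) -> borel [set A | forall x, G x A].
Proof.
move=> mG; rewrite (_ : [set A | _] = [set A | ~ exists x, ~ G x A]).
  by apply: borel_not; apply: borel_ex => x; exact: borel_not.
apply/seteqP; split=> A /= H; first by move=> [x]; apply.
by move=> x; apply: contrapT => h; apply: H; exists x.
Qed.

Lemma borel_imp (p : Prop) S : borel S -> borel [set A | p -> S A].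
Proof.
move=> mS; rewrite (_ : [set A | _] = [set A | ~ p \/ S A]).
  exact: (borel_or (borel_cst _) mS).
apply/seteqP; split=> A /= H; last by move=> ?; case: H.
by have [/H|] := pselect p; [right|left].
Qed.

Lemma borel_lunit : borel (@lunit_mx R F m n).
Proof.
apply: open_borel; apply: open_digits => A AI; exists 0 => B AB k i.
have := AI k i; rewrite -(expr0z (#|F|%:R : R)) => /lnorm_ltP H.
by apply/lnorm_ltP => j j0; rewrite -AB//; exact: H.
Qed.

Lemma borel_frac_digit (q : Q) i s (v : F) :
  borel [set A | frac_digit q A i s = v].
Proof.
apply: open_borel; apply: open_digits => A /= Av.
exists (- (s + row_size q).+1%:Z) => B AB.
rewrite -Av !(frac_digitE _ _ _ (size_row q)).
apply: eq_bigr => k _; apply: eq_bigr => e _; rewrite AB//.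
by have := ltn_ord e; lia.
Qed.

Lemma digit_mx_lunit (k : 'I_m) (i : 'I_n) s (c : F) :
  lunit_mx (digit_mx R k i s c).
Proof.
move=> k' i'; rewrite mxE; case: ifP => _; last by rewrite lnorm0.
rewrite -(expr0z (#|F|%:R : R)); apply/lnorm_ltP => j j0 /=.
by case: eqVneq => // ?; lia.
Qed.

Lemma lunitD (A B : MX) : @lunit_mx R F m n A -> lunit_mx B -> lunit_mx (A + B).
Proof.
move=> AI BI k i; rewrite mxE; apply: le_lt_trans (lnorm_ultra _ _) _.
by rewrite gt_max AI BI.
Qed.

Lemma lunitN (A : MX) : @lunit_mx R F m n A -> lunit_mx (- A).
Proof. by move=> AI k i; rewrite mxE lnormN. Qed.

End BorelSets.

Section HaarProbability.
Variables (R : realType) (F : finFieldType) (m n : nat).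
Local Notation L := (laurent R F).
Local Notation Q := 'rV[{poly F}]_m.
Local Notation MX := 'M[L]_(m, n).
Variable mu : {measure set (lmx_borel R F m n) -> \bar R}.
Hypothesis mu_haar : haar_measure mu.
Hypothesis mu_unit : mu (@lunit_mx R F m n) = 1%E.
Implicit Types (S : set MX) (q : Q).

Let I : set MX := @lunit_mx R F m n.

(** Intersecting with the unit matrices, a subgroup of measure 1, gives every
    Borel set a finite probability that unit translations preserve. *)
Definition prob S : R := fine (mu (S `&` @lunit_mx R F m n)).

Let bI S : borel S -> borel (S `&` I).
Proof. by move=> mS; apply: borel_and => //; exact: borel_lunit. Qed.

Lemma mu_le1 S : borel S -> (mu (S `&` I) <= 1)%E.
Proof.
move=> mS; rewrite -mu_unit; apply: le_measure; rewrite ?inE.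
- exact: bI.
- exact: borel_lunit.
- exact: subIsetr.
Qed.

Lemma probE S : borel S -> mu (S `&` I) = (prob S)%:E.
Proof.
move=> mS; rewrite /prob fineK// fin_numE; apply/andP; split.
  by rewrite gt_eqF// (lt_le_trans _ (measure_ge0 _ _)).
by rewrite lt_eqF// (le_lt_trans (mu_le1 mS))// ltry.
Qed.

Lemma prob_ge0 S : 0 <= prob S.
Proof. exact/fine_ge0/measure_ge0. Qed.

Lemma prob_le1 S : borel S -> prob S <= 1.
Proof. by move=> mS; rewrite -lee_fin -probE// mu_le1. Qed.

Lemma prob_le S S' : borel S -> borel S' -> S `<=` S' -> prob S <= prob S'.
Proof.
move=> mS mS' SS'; rewrite -lee_fin -!probE//; apply: le_measure; rewrite ?inE.
- exact: bI.
- exact: bI.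
- exact: setSI.
Qed.

Lemma probT : prob setT = 1.
Proof. by rewrite /prob setTI mu_unit. Qed.

Lemma prob0 : prob set0 = 0.
Proof. by rewrite /prob set0I measure0. Qed.

Lemma prob_split S S' : borel S -> borel S' ->
  prob S = prob [set A | S A /\ S' A] + prob [set A | S A /\ ~ S' A].
Proof.
move=> mS mS'; apply: EFin_inj; rewrite EFinD -!probE//; last 2 first.
- exact: (borel_and mS (borel_not mS')).
- exact: borel_and.
rewrite addeC (measureDI mu (bI mS) (bI mS')); congr (mu _ + mu _)%E.
  apply/seteqP; split => A /=; first by move=> [[? ?] nA]; split=> //; split => // ?; apply: nA.
  by move=> [[? ?] ?]; split => // -[].
by apply/seteqP; split => A /=; [move=> [[? ?] [? ?]]|move=> [[? ?] ?]].
Qed.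

Lemma prob_or S S' : borel S -> borel S' ->
  prob [set A | S A \/ S' A] <= prob S + prob S'.
Proof.
move=> mS mS'; rewrite (prob_split (borel_or mS mS') mS) lerD//.
  by apply: prob_le => //; [exact: borel_and (borel_or _ _) _|move=> A []].
apply: prob_le => //; first exact: borel_and (borel_or _ _) (borel_not _).
by move=> A [[]].
Qed.

Lemma prob_ex_le (T : eqType) (s : seq T) (G : T -> set MX) :
  (forall x, borel (G x)) ->
  borel [set A | exists2 x, x \in s & G x A] /\
  prob [set A | exists2 x, x \in s & G x A] <= \sum_(x <- s) prob (G x).
Proof.
move=> mG; elim: s => [|y s [IHm IH]].
  rewrite big_nil (_ : [set A | _] = set0).
    by rewrite prob0; split => //; exact: measurable0.
  by apply/seteqP; split => A //= -[].
rewrite (_ : [set A | _] = [set A | G y A \/ (exists2 x, x \in s & G x A)]).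
  split; first exact: (borel_or _ IHm).
  by rewrite big_cons (le_trans (prob_or (mG y) IHm))// lerD2l.
apply/seteqP; split => A /=.
  by move=> [x]; rewrite inE => /predU1P[->|xs]; [left|right; exists x].
by move=> [?|[x xs ?]]; [exists y; rewrite ?mem_head|exists x; rewrite ?inE ?xs ?orbT].
Qed.

Lemma prob_ex_disj (T : eqType) (s : seq T) (G : T -> set MX) : uniq s ->
  (forall x, borel (G x)) -> (forall x y A, G x A -> G y A -> x = y) ->
  prob [set A | exists2 x, x \in s & G x A] = \sum_(x <- s) prob (G x).
Proof.
move=> us mG dG; elim: s us => [_|y s IH /= /andP[ys us]].
  rewrite big_nil (_ : [set A | _] = set0) ?prob0//.
  by apply/seteqP; split => A //= -[].
rewrite big_cons -IH//.
have [mE _] := prob_ex_le (y :: s) mG.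
rewrite (prob_split mE (mG y)); congr (prob _ + prob _).
  apply/seteqP; split => A /= => [[]//|GA].
  by split => //; exists y => //; rewrite inE eqxx.
apply/seteqP; split => A /=.
  by move=> [[x]]; rewrite inE => /predU1P[->//|xs Gx _]; exists x.
move=> [x xs Gx]; split; first by exists x => //; rewrite inE xs orbT.
by move=> Gy; move: ys; rewrite (dG _ _ _ Gy Gx) xs.
Qed.

Lemma prob_shift S (B : MX) : borel S -> lunit_mx B ->
  prob [set A | S (A + B)] = prob S.
Proof.
move=> mS BI; rewrite /prob.
have <- := haar_translation mu_haar (- B) (bI mS); congr (fine (mu _)).
apply/seteqP; split => [A [/= SA AI]|_ [A [SA AI]] <-].
  exists (A + B); first by split => //; exact: lunitD.
  by rewrite addrC addrK.
by rewrite /= addrC addrA subrr add0r; split=> //; apply: lunitD => //; exact: lunitN.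
Qed.

(** If [S] does not see one digit of one entry, and that digit enters a
    fractional digit of [q A] with a nonzero coefficient, then that fractional
    digit is uniform and independent of [S]: moving the digit permutes its
    values and preserves both [S] and the measure. *)
Lemma prob_fresh_digit S q (k : 'I_m) (i : 'I_n) (s e : nat) :
  borel S -> size (q 0 k) = e.+1 ->
  (forall c A, S A -> S (A + digit_mx R k i (s + e) c)) ->
  prob [set A | S A /\ frac_digit q A i s = 0] = prob S / #|F|%:R.
Proof.
move=> mS qe inv.
have le0 : (q 0 k)`_e != 0.
  by move: (lead_coef_eq0 (q 0 k)); rewrite lead_coefE qe /= => ->; rewrite -size_poly_eq0 qe.
pose G v := [set A | S A /\ frac_digit q A i s = v].
have mG v : borel (G v) by apply: borel_and => //; exact: borel_frac_digit.
have -> : prob S = \sum_(v <- enum F) prob (G v).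
  rewrite -prob_ex_disj ?enum_uniq//; last by move=> x y A [_ <-] [_ <-].
  congr prob; apply/seteqP; split => A /= => [SA|[v _ []]//].
  by exists (frac_digit q A i s) => //; rewrite mem_enum.
rewrite (eq_bigr (fun=> prob (G 0))).
  rewrite big_const_seq count_predT -cardE iter_addr_0.
  rewrite -(mulr_natr (prob (G 0))) mulfK// pnatr_eq0 -lt0n.
  by rewrite (ltn_trans _ (card_finNzRing_gt1 F)).
(* Adding this multiple of the digit moves the value 0 to the value v. *)
move=> v _; rewrite -(prob_shift (mG v) (digit_mx_lunit R k i (s + e) (v / (q 0 k)`_e))).
congr prob; apply/seteqP; split => A /= [SA].
  rewrite frac_digitD frac_digit_mx eqxx leq_addr addKn mulrC divfK// => fv.
  split; last by apply: (addIr v); rewrite fv add0r.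
  have := inv (- (v / (q 0 k)`_e)) _ SA.
  rewrite (_ : _ + _ + _ = A)//; apply/matrixP => x y; rewrite !mxE; case: ifP => _.
    apply: laurentP => z /=; case: eqVneq => _; rewrite ?addrK//.
    by rewrite !addr0.
  by rewrite !addr0.
move=> fA; split; first exact: inv.
by rewrite frac_digitD frac_digit_mx eqxx leq_addr addKn mulrC divfK// fA add0r.
Qed.

End HaarProbability.

(** * Digit constraints in a linear order *)

Section Constraints.
Variables (R : realType) (F : finFieldType) (m n : nat).
Local Notation L := (laurent R F).
Local Notation Q := 'rV[{poly F}]_m.
Local Notation MX := 'M[L]_(m, n).
(* The constraint number [x] asks digit [depth (iota x) x] of column [iota x]
   to vanish: in each column the digits are met one after the other. *)
Variable iota : nat -> 'I_n.
Implicit Types (S : set MX) (q : Q) (A : MX) (D : 'I_m -> nat) (k : 'I_m).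

Definition depth (i : 'I_n) (r : nat) : nat := \sum_(y < r) (iota y == i).

Definition vanishes q (r : nat) A : Prop :=
  forall x, (x < r)%N -> frac_digit q A (iota x) (depth (iota x) x) = 0.

Lemma depthS i r : depth i r.+1 = (depth i r + (iota r == i))%N.
Proof. by rewrite /depth big_ord_recr. Qed.

Lemma depth_le i r r' : (r <= r')%N -> (depth i r <= depth i r')%N.
Proof.
by move=> /subnK <-; elim: (r' - r)%N => // d IH; rewrite addSn depthS (leq_trans IH)// leq_addr.
Qed.

Lemma depth_lt i y x : (y < x)%N -> iota y = i -> (depth i y < depth i x)%N.
Proof. by move=> yx yi; rewrite (leq_trans _ (depth_le i yx))// depthS yi eqxx addn1. Qed.

Lemma depth_ex i r s : (s < depth i r)%N ->
  exists x, [/\ (x < r)%N, iota x = i & depth i x = s].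
Proof.
elim: r => [|r IH]; first by rewrite /depth big_ord0.
rewrite depthS; case: eqVneq => [ri|_]; last first.
  by rewrite addn0 => /IH[x [xr ? ?]]; exists x; split => //; rewrite ltnW.
rewrite addn1 ltnS leq_eqVlt => /orP[/eqP ->|]; first by exists r.
by move=> /IH[x [xr ? ?]]; exists x; split => //; rewrite ltnW.
Qed.

Lemma vanishesP q r A : vanishes q r A <->
  forall i s, (s < depth i r)%N -> frac_digit q A i s = 0.
Proof.
split => [H i s /depth_ex[x [xr <- <-]]|H x xr]; first exact: H.
exact/H/depth_lt.
Qed.

Lemma vanishes_le q r r' A : (r <= r')%N -> vanishes q r' A -> vanishes q r A.
Proof. by move=> rr H x xr; apply: H; rewrite (leq_trans xr). Qed.

Lemma vanishesS q r A : vanishes q r.+1 A <->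
  vanishes q r A /\ frac_digit q A (iota r) (depth (iota r) r) = 0.
Proof.
split=> [H|[H Hr] x]; first by split; [exact: vanishes_le H|exact: H].
by rewrite ltnS leq_eqVlt => /orP[/eqP ->|/H].
Qed.

Lemma borel_vanishes q r : borel [set A : MX | vanishes q r A].
Proof. by apply: borel_all => x; apply: borel_imp; exact: borel_frac_digit. Qed.

(** A constraint looks at the digits of the [k]-th entry only down to its own
    depth plus the degree of [q_k]. Constraints are met in order of increasing
    depth, so the leading digit of a later one is invisible to the earlier
    ones. *)
Lemma vanishes_shift q k (e r x : nat) (c : F) A :
  (size (q 0 k)%R <= e.+1)%N -> (r <= x)%N ->
  vanishes q r (A + digit_mx R k (iota x) (depth (iota x) x + e) c) <->
  vanishes q r A.
Proof.
move=> qe rx.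
have E y : (y < r)%N ->
    frac_digit q (A + digit_mx R k (iota x) (depth (iota x) x + e) c)
      (iota y) (depth (iota y) y) = frac_digit q A (iota y) (depth (iota y) y).
  move=> yr; rewrite frac_digitD frac_digit_mx.
  case: eqVneq => [yx|_] /=; last by rewrite addr0.
  have := depth_lt (leq_trans yr rx) yx; rewrite yx => dd.
  case: ifP => _; last by rewrite addr0.
  by rewrite nth_default ?mul0r ?addr0// (leq_trans qe)//; lia.
by split=> H y yr; have := H y yr; rewrite E.
Qed.

Definition inbox D q : Prop := forall k, (size (q 0 k)%R <= D k)%N.

Definition box D := {dffun forall k : 'I_m, 'rV[F]_(D k)}.

Definition box_row D (f : box D) : Q := \row_k rVpoly (f k).

Lemma box_row_inj D : injective (@box_row D).
Proof.
move=> f g /rowP fg; apply/ffunP => k; have := fg k; rewrite !mxE.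
exact: (can_inj rVpolyK).
Qed.

Lemma box_row_in D (f : box D) : inbox D (box_row f).
Proof. by move=> k; rewrite mxE size_poly. Qed.

Lemma box_rowP D q : inbox D q -> exists f : box D, q = box_row f.
Proof.
move=> qD; exists [ffun k => poly_rV (q 0 k)].
by apply/rowP => k; rewrite !mxE ffunE poly_rV_K.
Qed.

Lemma card_box D : #|{: box D}| = (#|F| ^ \sum_k D k)%N.
Proof.
rewrite card_dep_ffun foldrE big_map big_enum /= expn_sum.
by apply: eq_bigr => k _; rewrite card_mx mul1n.
Qed.

Definition box_seq D : seq Q := [seq box_row f | f <- enum (box D)].

Lemma mem_box_seq D q : q \in box_seq D <-> inbox D q.
Proof.
split=> [/mapP[f _ ->]|/box_rowP[f ->]]; first exact: box_row_in.
by apply: map_f; rewrite mem_enum.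
Qed.

Lemma box_seq_uniq D : uniq (box_seq D).
Proof. by rewrite map_inj_uniq ?enum_uniq//; exact: box_row_inj. Qed.

Lemma size_box_seq D : size (box_seq D) = (#|F| ^ \sum_k D k)%N.
Proof. by rewrite size_map -cardE card_box. Qed.

(** The box has more vectors than the [r] digits have joint values; the
    difference of two vectors with equal digits satisfies all constraints. *)
Lemma vanishes_ex D r A : (r < \sum_k D k)%N ->
  exists q, [/\ q != 0, inbox D q & vanishes q r A].
Proof.
move=> rD.
pose h (f : box D) : {ffun 'I_r -> F} :=
  [ffun x : 'I_r => frac_digit (box_row f) A (iota x) (depth (iota x) x)].
have /injectivePn[f [g fg hfg]] : ~~ injectiveb h.
  apply/negP => /injectiveP hi; have := leq_card h hi.
  by rewrite card_box card_ffun card_ord leq_exp2l ?card_finNzRing_gt1// leqNgt rD.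
exists (box_row f - box_row g); split.
- by rewrite subr_eq0; apply: contra fg => /eqP/box_row_inj ->.
- move=> k; rewrite !mxE (leq_trans (size_polyD _ _))// size_polyN geq_max.
  by rewrite !size_poly.
- move=> x xr; rewrite frac_digitBl.
  by have /ffunP/(_ (Ordinal xr)) := hfg; rewrite !ffunE /= => ->; rewrite subrr.
Qed.

Variable mu : {measure set (lmx_borel R F m n) -> \bar R}.
Hypothesis mu_haar : haar_measure mu.
Hypothesis mu_unit : mu (@lunit_mx R F m n) = 1%E.
Local Notation prob := (prob mu).

(** If [S] forces the first [r] constraints and does not see the digits that
    the leading coefficient of [q_k] brings into the later ones, each later
    constraint is a fresh digit for [S] and all the constraints before it. *)
Lemma prob_vanishes S q k (e r r' : nat) : borel S -> size (q 0 k) = e.+1 ->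
  (forall A, S A -> vanishes q r A) ->
  (forall x c A, (r <= x)%N -> S A ->
     S (A + digit_mx R k (iota x) (depth (iota x) x + e) c)) ->
  prob [set A | S A /\ vanishes q r' A] = prob S / #|F|%:R ^+ (r' - r).
Proof.
move=> mS qe Sr inv; have [r'r|/ltnW rr'] := leqP r' r.
  rewrite (eqP r'r) expr0 divr1; congr prob; apply/seteqP; split => A /= => [[]//|SA].
  by split=> //; apply: vanishes_le (Sr _ SA).
rewrite -{1}(subnKC rr'); elim: (r' - r)%N => [|d IH].
  rewrite expr0 divr1 addn0; congr prob; apply/seteqP; split => A /= => [[]//|SA].
  by split=> //; exact: Sr.
rewrite exprSr invfM mulrA -IH.
rewrite -(prob_fresh_digit mu_haar mu_unit 
  (i := iota (r + d)) (s := depth (iota (r + d)) (r + d)) _ qe).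
- congr prob; apply/seteqP; split=> A /=; rewrite addnS vanishesS.
    by move=> [SA [? ?]].
  by move=> [[SA ?] ?].
- by apply: borel_and => //; exact: borel_vanishes.
- move=> c A [SA vA]; split; first by apply: inv => //; exact: leq_addr.
  by rewrite vanishes_shift// qe.
Qed.

Lemma prob_vanishes_nz q r : q != 0 ->
  prob [set A | vanishes q r A] = (#|F|%:R ^+ r)^-1.
Proof.
move=> q0; have [k qk] : exists k, q 0 k != 0.
  by apply/rV0Pn.
have := @prob_vanishes setT q k (size (q 0 k)).-1 0 r.
rewrite prednK ?size_poly_gt0// probT// subn0 mul1r => <- //.
  by congr prob; apply/seteqP; split => A /= => [|[]].
exact: measurableT.
Qed.

(** The union bound over the [t^C] vectors of the box. *)
Lemma prob_box D r :
  prob [set A | exists q, [/\ q != 0, inbox D q & vanishes q r A]] <=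
  #|F|%:R ^+ (\sum_k D k) / #|F|%:R ^+ r.
Proof.
pose G q : set MX := [set A | q != 0 /\ vanishes q r A].
have mG q : borel (G q).
  by apply: borel_and; [exact: borel_cst|exact: borel_vanishes].
have [_ H] := prob_ex_le mu_unit (box_seq D) mG.
have -> : [set A | exists q, [/\ q != 0, inbox D q & vanishes q r A]] =
    [set A | exists2 q, q \in box_seq D & G q A].
  apply/seteqP; split => A /=.
    by move=> [q [? /mem_box_seq ? ?]]; exists q.
  by move=> [q /mem_box_seq ? [? ?]]; exists q.
apply: le_trans H _.
rewrite -natrX -(size_box_seq D).
elim: (box_seq D) => [|q s IH]; first by rewrite big_nil mul0r.
rewrite big_cons /= -natr1 mulrDl addrC lerD//.
rewrite mul1r; have [q0|q0] := eqVneq q 0.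
  rewrite (_ : G q = set0) ?prob0 ?invr_ge0 ?exprn_ge0//.
  by apply/seteqP; split => A //= -[]; rewrite q0 eqxx.
rewrite -(prob_vanishes_nz r q0); apply: prob_le => //; last by move=> A [].
exact: borel_vanishes.
Qed.

End Constraints.

(** * A linear order compatible with all stages *)

Lemma sum_eq n (a : 'I_n) : (\sum_i (a == i) = 1)%N.
Proof.
rewrite (bigD1 a)//= eqxx big1// => i.
by rewrite eq_sym => /negbTE ->.
Qed.

(** List, stage after stage, the constraints that the stage adds to the previous
    one. Since [l] is monotone in the stage, the first [sum_i l j i] of them are
    then those required at stage [j]. *)
Lemma row_order n (n_gt0 : (0 < n)%N) (l : nat -> 'I_n -> nat) (N : nat) :
  (forall j i, (l j i <= l j.+1 i)%N) ->
  exists iota : nat -> 'I_n, forall j i, (j <= N)%N ->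
    depth iota i (\sum_i' l j i')%N = l j i.
Proof.
move=> hl.
have ln j N' : (j <= N')%N -> forall i, (l j i <= l N' i)%N.
  move=> /subnK <-; elim: (N' - j)%N => // d IH i.
  by rewrite addSn (leq_trans (IH i)).
have hs (s : seq 'I_n) (h : 'I_n -> nat) :
    (forall i, count_mem i s = h i) -> size s = (\sum_i h i)%N.
  move=> sh; under eq_bigr do rewrite -sh.
  elim: s {sh} => [|a s IH]; first by rewrite big1.
  by rewrite /= IH big_split /= sum_eq.
(* Beyond the end of the list the default value just repeats one column. *)
suff [s Hs] : exists s : seq 'I_n, forall j i, (j <= N)%N ->
    count_mem i (take (\sum_i' l j i')%N s) = l j i.
  exists (nth (Ordinal n_gt0) s) => j i jN; rewrite -[RHS](Hs j i jN) /depth.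
  have : (\sum_i' l j i' <= size s)%N.
    rewrite -(hs (take (\sum_i' l j i')%N s)) ?size_take; last by move=> ?; exact: Hs.
    by case: ltnP => // /ltnW.
  move: (\sum_i' l j i')%N => r; elim: r => [|r IH] rs.
    by rewrite big_ord0 take0.
  rewrite big_ord_recr /= IH ?(ltnW rs)//.
  by rewrite (take_nth (Ordinal n_gt0) rs) -cats1 count_cat /= addn0.
elim: N => [|N [s Hs]].
  exists (flatten [seq nseq (l 0%N i) i | i <- enum 'I_n]) => j i.
  rewrite leqn0 => /eqP ->.
  have hc i' : count_mem i' (flatten [seq nseq (l 0%N i) i | i <- enum 'I_n]) = l 0%N i'.
    rewrite count_flatten -map_comp sumnE big_map big_enum /= (bigD1 i')//=.
    by rewrite count_nseq /= eqxx mul1n big1 ?addn0// => a /negbTE ai; rewrite count_nseq /= ai.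
  by rewrite -(hs _ _ hc) take_size hc.
pose b := flatten [seq nseq (l N.+1 i - l N i) i | i <- enum 'I_n].
pose s0 := take (\sum_i l N i)%N s.
have hb i' : count_mem i' b = (l N.+1 i' - l N i')%N.
  rewrite count_flatten -map_comp sumnE big_map big_enum /= (bigD1 i')//=.
  by rewrite count_nseq /= eqxx mul1n big1 ?addn0// => a /negbTE ai; rewrite count_nseq /= ai.
have ss0 : size s0 = (\sum_i l N i)%N by apply: hs => i; exact: Hs.
have hc i : count_mem i (s0 ++ b) = l N.+1 i by rewrite count_cat hb Hs// subnKC// hl.
exists (s0 ++ b) => j i; rewrite leq_eqVlt ltnS => /orP[/eqP ->|jN].
  by rewrite -(hs _ _ hc) take_size hc.
have jNs : (\sum_i' l j i' <= \sum_i' l N i')%N by apply: leq_sum => i' _; exact: ln.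
by rewrite takel_cat ?ss0// /s0 take_takel// Hs.
Qed.

(** * Minimal vectors and the stagewise construction *)

Section MinimalVectors.
Variables (R : realType) (F : finFieldType) (m n : nat).
Local Notation L := (laurent R F).
Local Notation Q := 'rV[{poly F}]_m.
Local Notation MX := 'M[L]_(m, n).
Variable iota : nat -> 'I_n.
Variable k0 : 'I_m.
Implicit Types (S : set MX) (q : Q) (A : MX) (D : 'I_m -> nat) (k : 'I_m).
Local Notation vanishes := (vanishes iota).

(** The first vector, up to scaling, that satisfies [r] constraints when the
    degree bound in the coordinate [k0] is raised step by step. The bound [D k0]
    itself must not be enough, so that the leading digit of [q_k0] is fresh. *)
Definition minimal_vector D (r : nat) q A : Prop :=
  [/\ q 0 k0 \is monic, (D k0 < size (q 0 k0)%R)%N,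
      forall k, k != k0 -> (size (q 0 k)%R <= D k)%N, vanishes q r A &
      forall q', q' != 0 -> (size (q' 0 k0)%R < size (q 0 k0)%R)%N ->
        (forall k, k != k0 -> (size (q' 0 k)%R <= D k)%N) ->
        ~ vanishes q' r A].

Definition widen D (w : nat) (k : 'I_m) : nat := D k + (if k == k0 then w else 0).

Lemma sum_widen D w : (\sum_k widen D w k = \sum_k D k + w)%N.
Proof.
rewrite /widen big_split /=; congr (_ + _)%N.
by rewrite (bigD1 k0)//= eqxx big1 ?addn0// => k /negbTE ->.
Qed.

(** With [w + 1] more degrees than [C] there are more unknowns than the [C + w]
    constraints; a solution of least size in [k0] is made monic. *)
Lemma minimal_vector_ex D w A :
  ~ (exists q, [/\ q != 0, inbox D q & vanishes q (\sum_k D k + w) A]) ->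
  exists2 q, minimal_vector D (\sum_k D k + w) q A & inbox (widen D w.+1) q.
Proof.
set r := (_ + w)%N => noD.
pose P s := `[< exists q, [/\ q != 0, inbox (widen D w.+1) q, vanishes q r A
                           & size (q 0 k0)%R = s] >].
have /ex_minnP[s /asboolP[q [q0 qw qv qs]] smin] : exists s, P s.
  have [|q [q0 qw qv]] := @vanishes_ex R F m n iota (widen D w.+1) r A.
    by rewrite sum_widen addnS.
  by exists (size (q 0 k0)); apply/asboolP; exists q.
have qk k : k != k0 -> (size (q 0 k)%R <= D k)%N.
  by move=> /negbTE kk; have := qw k; rewrite /widen kk addn0.
have sD : (D k0 < s)%N.
  rewrite ltnNge; apply/negP => sD; apply: noD; exists q; split=> // k.
  by have [->|/qk//] := eqVneq k k0; rewrite qs.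
have c0 : lead_coef (q 0 k0) != 0.
  by rewrite lead_coef_eq0 -size_poly_eq0 qs -lt0n (leq_trans _ sD).
pose c := (lead_coef (q 0 k0))^-1.
have cs k : size ((c%:P *: q) 0 k)%R = size (q 0 k)%R.
  by rewrite mxE mul_polyC size_scale// invr_eq0.
(* Any smaller solution would lie in the widened box too. *)
exists (c%:P *: q); last by move=> k; rewrite cs.
split; rewrite ?cs ?qs//.
- by rewrite mxE mul_polyC monicE lead_coefZ mulVf.
- by move=> k kk; rewrite cs qk.
- by move=> x xr; rewrite frac_digitZl qv// mulr0.
- move=> q' q'0 q's q'k q'v; move: (q's); rewrite ltnNge => /negP; apply.
  apply: smin; apply/asboolP; exists q'; split=> // k.
  rewrite /widen; case: eqVneq => [->|/q'k]; last by rewrite addn0.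
  by have := qw k0; rewrite /widen eqxx qs; apply: leq_trans; exact: ltnW.
Qed.

(** The difference of two monic candidates of the same size is a smaller one. *)
Lemma minimal_vector_uniq D r q q' A :
  minimal_vector D r q A -> minimal_vector D r q' A -> q = q'.
Proof.
move=> [qm qD qk qv qmin] [q'm q'D q'k q'v q'min].
have nz (p : Q) : (D k0 < size (p 0 k0)%R)%N -> p != 0.
  by apply: contraTneq => ->; rewrite mxE size_poly0.
have ss : size (q 0 k0) = size (q' 0 k0).
  apply/eqP; rewrite eqn_leq; apply/andP; split; rewrite leqNgt; apply/negP => h.
    exact: (qmin q' (nz _ q'D) h q'k q'v).
  exact: (q'min q (nz _ qD) h qk qv).
apply/eqP; rewrite -subr_eq0; apply/negP => /negP d0.
apply: (qmin (q - q') d0).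
- rewrite !mxE; have q0 : q 0 k0 != 0 by exact: monic_neq0.
  have := @leqnn (size (q 0 k0)); rewrite -{1}(prednK (n := size (q 0 k0))) ?size_poly_gt0//.
  apply: leq_trans; rewrite ltnS; apply/leq_sizeP => a; rewrite leq_eqVlt => /orP[/eqP <-|].
    rewrite coefB; have := monicP qm; rewrite lead_coefE => ->.
    by have := monicP q'm; rewrite lead_coefE -ss => ->; rewrite subrr.
  rewrite prednK ?size_poly_gt0// => ha.
  by rewrite coefB !nth_default ?subrr// -?ss.
- move=> k kk; rewrite !mxE (leq_trans (size_polyD _ _))// size_polyN geq_max.
  by rewrite qk// q'k.
- by move=> x xr; rewrite frac_digitBl qv// q'v// subrr.
Qed.

Lemma borel_minimal D r q : borel [set A | minimal_vector D r q A].
Proof.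
rewrite (_ : [set A | _] = [set A | [/\ q 0 k0 \is monic,
      (D k0 < size (q 0 k0)%R)%N &
      forall k, k != k0 -> (size (q 0 k)%R <= D k)%N] /\ (vanishes q r A /\
      forall q', q' != 0 -> (size (q' 0 k0)%R < size (q 0 k0)%R)%N ->
        (forall k, k != k0 -> (size (q' 0 k)%R <= D k)%N) ->
        ~ vanishes q' r A)]); last first.
  by apply/seteqP; split => A /= => [[]|[[] ? ? ? []]].
apply: borel_and; first exact: borel_cst.
apply: borel_and; first exact: borel_vanishes.
apply: borel_all => q'; do 3! apply: borel_imp.
by apply: borel_not; exact: borel_vanishes.
Qed.

(** Minimality only involves vectors of size at most that of [q_k0], so it is
    decided before the fresh digits. *)
Lemma minimal_vector_shift D r q (e x : nat) (c : F) A :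
  (size (q 0 k0)%R <= e.+1)%N -> (r <= x)%N ->
  minimal_vector D r q (A + digit_mx R k0 (iota x) (depth iota (iota x) x + e) c) <->
  minimal_vector D r q A.
Proof.
move=> qe rx; split=> [] [qm qD qk qv qmin]; split=> //.
- by move: qv; rewrite vanishes_shift.
- move=> p p0 ps pk pv; apply: (qmin p p0 ps pk).
  by rewrite vanishes_shift// (leq_trans (ltnW ps)).
- by rewrite vanishes_shift.
- move=> p p0 ps pk; rewrite vanishes_shift ?(leq_trans (ltnW ps))//.
  exact: qmin.
Qed.

Variables (D : nat -> 'I_m -> nat) (w : nat) (rho : nat -> nat).
Hypothesis D_grows : forall i k, (widen (D i) w.+1 k <= D i.+1 k)%N.

Let r i := (\sum_k D i k + w)%N.

(** The bound by the widened box makes the successful vector a member of the box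
    of the next stage, which is what later stages compare it with. *)
Definition hit i A : Prop := exists q,
  [/\ minimal_vector (D i) (r i) q A, inbox (widen (D i) w.+1) q
    & vanishes q (rho i) A].

Definition nondegenerate i A : Prop :=
  exists2 q, minimal_vector (D i) (r i) q A & inbox (widen (D i) w.+1) q.

Definition no_hit i A : Prop := forall j, (j < i)%N -> ~ hit j A.

Lemma D_widen j i k : (j < i)%N -> (widen (D j) w.+1 k <= D i k)%N.
Proof.
move=> /subnK <-; elim: (i - j.+1)%N => // d IH; apply: leq_trans IH _.
by rewrite !addSn addnS (leq_trans _ (D_grows _ _))// leq_addr.
Qed.

Lemma D_le j i k : (j < i)%N -> (D j k <= D i k)%N.
Proof. by move=> ji; rewrite (leq_trans _ (D_widen k ji))// leq_addr. Qed.

(** An earlier hit either is decided by the first [r i] constraints, or it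
    provides a vector satisfying all of them, of degree too small for a minimal
    vector of stage [i] to exist. *)
Lemma no_hit_shift i q (e x : nat) (c : F) A :
  minimal_vector (D i) (r i) q A -> size (q 0 k0) = e.+1 -> (r i <= x)%N ->
  no_hit i A ->
  no_hit i (A + digit_mx R k0 (iota x) (depth iota (iota x) x + e) c).
Proof.
move=> qA qe rx noA j ji [p [pm pw pv]].
have qe' : (size (q 0 k0)%R <= e.+1)%N by rewrite qe.
have [_ qD _ _ qmin] := qA.
have pe : (size (p 0 k0)%R < size (q 0 k0)%R)%N.
  by rewrite (leq_ltn_trans _ qD)// (leq_trans (pw k0))// D_widen.
have pe' : (size (p 0 k0)%R <= e.+1)%N by rewrite -qe ltnW.
have rji : (r j <= r i)%N by rewrite leq_add2r; apply: leq_sum => k _; exact: D_le.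
have [rhor|/ltnW rrho] := leqP (rho j) (r i).
  apply: (noA j ji); exists p; split => //.
    by move/minimal_vector_shift : pm; apply; rewrite ?(leq_trans rji).
  by move/vanishes_shift : pv; apply; rewrite ?(leq_trans rhor).
have {}qmin := qmin p.
have p0 : p != 0.
  by case: pm => _ + _ _ _; apply: contraTneq => ->; rewrite mxE size_poly0.
apply: (qmin p0 pe) => [k kk|].
  by rewrite (leq_trans (pw k))// D_widen.
by move/(vanishes_le rrho)/vanishes_shift : pv; apply.
Qed.

Lemma borel_hit i : borel [set A | hit i A].
Proof.
apply: borel_ex => q.
rewrite (_ : (fun A => _) = [set A | minimal_vector (D i) (r i) q A /\
    (inbox (widen (D i) w.+1) q /\ vanishes q (rho i) A)]); last first.
  by apply/seteqP; split => A /= => [[]|[? []]].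
apply: borel_and; first exact: borel_minimal.
by apply: borel_and; [exact: borel_cst|exact: borel_vanishes].
Qed.

Lemma borel_nondegenerate i : borel [set A | nondegenerate i A].
Proof.
rewrite (_ : [set A | _] = [set A | exists q, minimal_vector (D i) (r i) q A /\
    inbox (widen (D i) w.+1) q]); last first.
  by apply/seteqP; split => A /= [q]; [exists q|case; exists q].
apply: borel_ex => q.
by apply: borel_and; [exact: borel_minimal|exact: borel_cst].
Qed.

Lemma borel_no_hit i : borel [set A | no_hit i A].
Proof.
by apply: borel_all => j; apply: borel_imp; apply: borel_not; exact: borel_hit.
Qed.

Variable mu : {measure set (lmx_borel R F m n) -> \bar R}.
Hypothesis mu_haar : haar_measure mu.
Hypothesis mu_unit : mu (@lunit_mx R F m n) = 1%E.
Local Notation prob := (prob mu).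
Local Notation t := (#|F|%:R : R).

(** Split according to the minimal vector: for each fixed one, the absence of
    earlier hits does not see the digits that decide the present hit. *)
Lemma prob_hit i :
  prob [set A | no_hit i A /\ hit i A] =
  prob [set A | no_hit i A /\ nondegenerate i A] / t ^+ (rho i - r i).
Proof.
pose G q : set MX := [set A | no_hit i A /\ minimal_vector (D i) (r i) q A].
have mG q : borel (G q).
  by apply: borel_and; [exact: borel_no_hit|exact: borel_minimal].
pose G' q : set MX := [set A | G q A /\ vanishes q (rho i) A].
have mG' q : borel (G' q) by apply: borel_and => //; exact: borel_vanishes.
pose s := box_seq F (widen (D i) w.+1).
have us : uniq s := box_seq_uniq _ _.
have -> : [set A | no_hit i A /\ hit i A] = [set A | exists2 q, q \in s & G' q A].
  apply/seteqP; split => A /=.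
    by move=> [? [q [? /mem_box_seq ? ?]]]; exists q.
  by move=> [q /mem_box_seq ? [[? ?] ?]]; split => //; exists q.
have -> : [set A | no_hit i A /\ nondegenerate i A] =
    [set A | exists2 q, q \in s & G q A].
  apply/seteqP; split => A /=.
    by move=> [? [q ? /mem_box_seq ?]]; exists q.
  by move=> [q /mem_box_seq ? [? ?]]; split => //; exists q.
rewrite (prob_ex_disj mu_unit us mG); last first.
  by move=> x y A [_ ?] [_ ?]; exact: (@minimal_vector_uniq (D i) (r i) x y A).
rewrite (prob_ex_disj mu_unit us mG'); last first.
  by move=> x y A [[_ ?] _] [[_ ?] _]; exact: (@minimal_vector_uniq (D i) (r i) x y A).
rewrite mulr_suml; apply: eq_bigr => q _.
have [qs|qs] := leqP (size (q 0 k0)) 0.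
  have -> : G' q = set0.
    by apply/seteqP; split => A //= [[_ [_ + _ _ _]] _]; rewrite ltnNge (leq_trans qs).
  have -> : G q = set0.
    by apply/seteqP; split => A //= [_ [_ + _ _ _]]; rewrite ltnNge (leq_trans qs).
  by rewrite prob0 mul0r.
have qe : size (q 0 k0) = (size (q 0 k0)).-1.+1 by rewrite prednK.
apply: (prob_vanishes mu_haar mu_unit _ (mG q) qe).
  by move=> A [_ []].
move=> x c A rx [noA qA]; split; first exact: no_hit_shift qA qe rx noA.
by rewrite minimal_vector_shift// -qe.
Qed.

Lemma prob_degenerate i : prob [set A | ~ nondegenerate i A] <= (t ^+ w)^-1.
Proof.
have t0 : 0 < t by rewrite (lt_trans _ (card_gt1 R F)).
have := prob_box iota mu_haar mu_unit (D i) (r i).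
rewrite /r exprD invfM mulrA divff ?mul1r ?expf_neq0 ?gt_eqF//.
apply: le_trans; apply: prob_le => //.
- by apply: borel_not; exact: borel_nondegenerate.
- apply: borel_ex => q.
  rewrite (_ : (fun A => _) = [set A | (q != 0 /\ inbox (D i) q) /\
      vanishes q (\sum_k D i k + w) A]); last first.
    by apply/seteqP; split => A /= => [[]|[[]]].
  by apply: borel_and; [exact: borel_cst|exact: borel_vanishes].
- move=> A /= H; apply: contrapT => H'; apply: H.
  by have [q] := minimal_vector_ex H'; exists q.
Qed.

Lemma prob_no_hitS i :
  prob [set A | no_hit i.+1 A] = prob [set A | no_hit i A] -
    prob [set A | no_hit i A /\ nondegenerate i A] / t ^+ (rho i - r i).
Proof.
rewrite (prob_split mu_unit (borel_no_hit i) (borel_hit i)) prob_hit addrAC subrr add0r.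
congr prob; apply/seteqP; split => A /= => [H|[H Hi] j].
  by split => [j ji|]; apply: H => //; rewrite ltnW.
by rewrite ltnS leq_eqVlt => /orP[/eqP ->//|/H].
Qed.

(** As long as the probability of no hit exceeds [2 t^-w], at least [t^-w] of it
    is nondegenerate, and stage [i] removes at least the fraction
    [t^-(rho i - r i)] of that amount. A total removal of more than 1 is
    impossible. *)
Lemma prob_no_hit N :
  prob [set A | no_hit N A] <= 2 / t ^+ w \/
  \sum_(i < N) (t ^+ (rho i - r i))^-1 <= t ^+ w.
Proof.
have t0 : 0 < t by rewrite (lt_trans _ (card_gt1 R F)).
have [|big] := leP; [by left|right].
have mono i j : (i <= j)%N -> prob [set A | no_hit j A] <= prob [set A | no_hit i A].
  move=> ij; apply: prob_le => //; try exact: borel_no_hit.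
  by move=> A H a ai; apply: H; rewrite (leq_trans ai).
have step i : (i < N)%N -> (t ^+ w)^-1 <= prob [set A | no_hit i A /\ nondegenerate i A].
  move=> iN; have := mono _ _ (ltnW iN).
  rewrite (prob_split mu_unit (borel_no_hit i) (borel_nondegenerate i)).
  have : prob [set A | no_hit i A /\ ~ nondegenerate i A] <= (t ^+ w)^-1.
    apply: le_trans (prob_degenerate i); apply: prob_le => //.
    - apply: borel_and; [exact: borel_no_hit|].
      by apply: borel_not; exact: borel_nondegenerate.
    - by apply: borel_not; exact: borel_nondegenerate.
    - by move=> A [].
  by move: big; lra.
suff H i : (i <= N)%N -> prob [set A | no_hit i A] <=
    1 - (t ^+ w)^-1 * \sum_(j < i) (t ^+ (rho j - r j))^-1.
  have := H N (leqnn _); have := prob_ge0 mu [set A | no_hit N A].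
  move=> h1 h2; rewrite -[leRHS]mulr1 -ler_pdivrMl ?exprn_gt0//; lra.
elim: i => [|i IH] iN.
  by rewrite big_ord0 mulr0 subr0 prob_le1//; exact: borel_no_hit.
rewrite prob_no_hitS big_ord_recr /= mulrDr.
have := IH (ltnW iN).
have : (t ^+ w)^-1 / t ^+ (rho i - r i) <=
    prob [set A | no_hit i A /\ nondegenerate i A] / t ^+ (rho i - r i).
  by rewrite ler_pM2r ?invr_gt0 ?exprn_gt0//; exact: step.
lra.
Qed.

End MinimalVectors.

(** * From real thresholds to degrees and digits *)

Section ApproximationLevels.
Variables (R : realType) (F : finFieldType) (m n : nat).
Local Notation L := (laurent R F).
Local Notation Q := 'rV[{poly F}]_m.
Local Notation MX := 'M[L]_(m, n).
Local Notation t := (#|F|%:R : R).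

Definition solvable (D : 'I_m -> nat) (l : 'I_n -> nat) (A : MX) : Prop :=
  exists q : Q, [/\ q != 0, inbox D q &
    forall i s, (s < l i)%N -> frac_digit q A i s = 0].

Lemma solvable_le D D' (l l' : 'I_n -> nat) A :
  (forall k, (D k <= D' k)%N) -> (forall i, (l' i <= l i)%N) ->
  solvable D l A -> solvable D' l' A.
Proof.
move=> DD ll [q [q0 qD ql]]; exists q; split => //.
  by move=> k; rewrite (leq_trans (qD k)).
by move=> i s sl; rewrite ql// (leq_trans sl).
Qed.

Lemma borel_solvable D l : borel [set A | solvable D l A].
Proof.
apply: borel_ex => q.
rewrite (_ : (fun A => _) = [set A | (q != 0 /\ inbox D q) /\
    forall i s, (s < l i)%N -> frac_digit q A i s = 0]); last first.
  by apply/seteqP; split => A /= => [[]|[[]]].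
apply: borel_and; first exact: borel_cst.
by apply: borel_all => i; apply: borel_all => s; apply: borel_imp; exact: borel_frac_digit.
Qed.

Let t1 : 1 < t := card_gt1 R F.
Let t0 : 0 < t := lt_trans ltr01 t1.

Lemma expr_unbounded (x : R) : exists k, x < t ^+ k.
Proof.
exists (Num.bound `|x|); apply: le_lt_trans (ler_norm x) _.
apply: lt_le_trans (archi_boundP (normr_ge0 x)) _.
by rewrite -natrX ler_nat ltnW// ltn_expl// card_finNzRing_gt1.
Qed.

(** The norm takes only powers of [t] as values, so a norm below 1 is less than
    [y] exactly when its first [l] digits vanish, for the least [l] with
    [t^-(l+1) < y]. *)
Lemma digit_level (y : R) : 0 < y ->
  exists l : nat, (t ^+ l.+1)^-1 < y /\ ((0 < l)%N -> y <= (t ^+ l)^-1).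
Proof.
move=> y0; have /ex_minnP[l ly lmin] : exists l, (t ^+ l.+1)^-1 < y.
  have [k yk] := expr_unbounded y^-1; exists k.
  rewrite invf_plt ?posrE ?exprn_gt0// (lt_le_trans yk)//.
  by rewrite ler_eXn2l.
exists l; split => // l0; rewrite leNgt; apply/negP => h.
by have := lmin l.-1; rewrite prednK// => /(_ h); rewrite -ltnS prednK// ltnn.
Qed.

Lemma degree_level (y : R) : 0 < y ->
  exists D : nat, y < t ^+ D /\ ((0 < D)%N -> t ^+ D.-1 <= y).
Proof.
move=> y0; have /ex_minnP[D Dy Dmin] := expr_unbounded y.
exists D; split => // D0; rewrite leNgt; apply/negP => h.
by have := Dmin _ h; rewrite -ltnS prednK// ltnn.
Qed.

Lemma digit_level_le (x y : R) (l l' : nat) : y <= x ->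
  ((0 < l)%N -> x <= (t ^+ l)^-1) -> (t ^+ l'.+1)^-1 < y -> (l <= l')%N.
Proof.
move=> yx; case: l => // l /(_ isT) xl yl; rewrite -ltnS.
have := lt_le_trans yl (le_trans yx xl).
by rewrite ltf_pV2 ?posrE ?exprn_gt0// ltr_eXn2l.
Qed.

Lemma degree_level_le (x y : R) (D D' d : nat) : t ^+ d * x <= y ->
  (0 < D)%N -> t ^+ D.-1 <= x -> y < t ^+ D' -> (D + d <= D')%N.
Proof.
move=> xy; case: D => // D _ /= xD yD.
have := le_lt_trans (le_trans _ xy) yD.
move=> /(_ (t ^+ (D + d))); rewrite exprD mulrC ler_pM2l ?exprn_gt0// => /(_ xD).
by rewrite mulrC -exprD ltr_eXn2l// addSn.
Qed.

Lemma degree_level_leW (x y : R) (D D' : nat) : x <= y ->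
  ((0 < D)%N -> t ^+ D.-1 <= x) -> y < t ^+ D' -> (D <= D')%N.
Proof.
case: D => // D xy /(_ isT) xD yD.
rewrite -[X in (X <= _)%N]addn0; apply: (degree_level_le _ _ xD yD) => //.
by rewrite expr0 mul1r.
Qed.

Lemma dist_poly_ltP (x : L) (y : R) (l : nat) :
  (t ^+ l.+1)^-1 < y -> ((0 < l)%N -> y <= (t ^+ l)^-1) ->
  dist_poly x < y <-> forall s, (s < l)%N -> lcoef x (- s.+1%:Z) = 0.
Proof.
move=> yl ly; have [p xp pmin] := dist_poly_min x; split.
  move=> xy s sl; have l0 : (0 < l)%N by apply: leq_trans sl.
  have := lt_le_trans xy (ly l0); rewrite xp exprnN => /lnorm_ltP.
  by move=> /(_ (- s.+1%:Z)) /= <-; rewrite ?subr0//; lia.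
move=> xl; apply: le_lt_trans yl.
have [a xa] := lcoef_bounded x.
(* Subtract the polynomial part of x. *)
rewrite xp (le_trans (pmin (\poly_(e < `|a|.+1) lcoef x e%:Z)))//.
rewrite exprnN; apply/lnorm_leP => -[j|j] jl /=.
  rewrite coef_poly; case: ltnP => [_|ja]; first by rewrite subrr.
  by rewrite xa ?subrr//; lia.
by rewrite subr0 NegzE xl//; move: jl; rewrite NegzE; lia.
Qed.

Lemma lnorm_lpoly_leP (p : {poly F}) (y : R) (D : nat) : 0 < y ->
  y < t ^+ D -> ((0 < D)%N -> t ^+ D.-1 <= y) ->
  lnorm (@lpoly R F p) <= y <-> (size p <= D)%N.
Proof.
move=> y0 yD Dy; split.
  move=> /le_lt_trans/(_ yD); rewrite exprnP => /lnorm_ltP H; apply/leq_sizeP => j Dj.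
  by have := H j; apply; rewrite lez_nat.
case: D yD Dy => [_ _|D _ /(_ isT) Dy pD].
  rewrite leqn0 size_poly_eq0 => /eqP ->.
  rewrite (_ : lpoly R 0 = 0) ?lnorm0 ?ltW//.
  by apply: laurentP => -[j|j] //=; rewrite coef0.
apply: le_trans Dy; rewrite exprnP; apply/lnorm_leP => -[j|//] Dj /=.
by rewrite nth_default// (leq_trans pD).
Qed.

Variable mu : {measure set (lmx_borel R F m n) -> \bar R}.
Hypothesis mu_haar : haar_measure mu.
Hypothesis mu_unit : mu (@lunit_mx R F m n) = 1%E.
Hypothesis n_gt0 : (0 < n)%N.
Local Notation prob := (prob mu).

Lemma prob_solvable D l :
  prob [set A | solvable D l A] <= t ^+ (\sum_k D k) / t ^+ (\sum_i l i).
Proof.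
have [iota /(_ 0%N _ isT) hiota] := @row_order n n_gt0 (fun=> l) 0 (fun _ _ => leqnn _).
apply: le_trans (prob_box iota mu_haar mu_unit _ _).
apply: prob_le => //; first exact: borel_solvable.
  apply: borel_ex => q.
  rewrite (_ : (fun A => _) = [set A | (q != 0 /\ inbox D q) /\
      vanishes iota q (\sum_i l i) A]); last first.
    by apply/seteqP; split => A /= => [[]|[[]]].
  by apply: borel_and; [exact: borel_cst|exact: borel_vanishes].
move=> A [q [q0 qD ql]]; exists q; split => //.
by apply/vanishesP => i s; rewrite hiota; exact: ql.
Qed.

(** A hit at stage [j] is a solution at stage [j.+1], whose box contains the
    widened box of stage [j]. *)
Lemma prob_never_solvable (k0 : 'I_m) (D : nat -> 'I_m -> nat)
    (l : nat -> 'I_n -> nat) (w N : nat) :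
  (forall i k, (widen k0 (D i) w.+1 k <= D i.+1 k)%N) ->
  (forall j i, (l j i <= l j.+1 i)%N) ->
  prob [set A | forall j, (j < N)%N -> ~ solvable (D j.+1) (l j.+1) A] <=
    2 / t ^+ w \/
  \sum_(j < N) (t ^+ (\sum_i l j.+1 i - (\sum_k D j k + w)))^-1 <= t ^+ w.
Proof.
move=> hD hl; have [iota hiota] := row_order n_gt0 N hl.
have [H|H] := @prob_no_hit _ _ _ _ iota k0 D w (fun j => \sum_i l j.+1 i)%N hD
    mu mu_haar mu_unit N; [left|by right].
apply: le_trans H; apply: prob_le => //.
- apply: borel_all => j; apply: borel_imp; apply: borel_not.
  exact: borel_solvable.
- exact: borel_no_hit.
- move=> A H j jN [q [[_ qD _ _ _] qw qv]]; apply: (H j jN); exists q; split.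
  + by apply: contraTneq qD => ->; rewrite mxE size_poly0.
  + by move=> k; rewrite (leq_trans (qw k)).
  + by move=> i s sl; move/vanishesP : qv; apply; rewrite hiota.
Qed.

End ApproximationLevels.

(** * Convergence and divergence of the series *)

Lemma infinite_natP (S : set nat) :
  infinite_set S <-> forall a, exists2 b, (a <= b)%N & S b.
Proof.
split=> [H a|H /finite_seqP[X SX]].
  apply: contrapT => Ha; apply: H; apply: (sub_finite_set _ (finite_II a)).
  move=> b Sb /=; rewrite ltnNge; apply/negP => ab.
  by apply: Ha; exists b.
have [b bX] := H (\max_(x <- X) x).+1; rewrite SX /= => Xb.
by move: bX; rewrite ltnNge (leq_bigmax_seq b).
Qed.

Section Thresholds.
Variables (R : realType) (F : finFieldType) (m n : nat).
Local Notation L := (laurent R F).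
Local Notation Q := 'rV[{poly F}]_m.
Local Notation MX := 'M[L]_(m, n).
Local Notation t := (#|F|%:R : R).
Let t1 : 1 < t := card_gt1 R F.
Let t0 : 0 < t := lt_trans ltr01 t1.

Variables (phi : 'I_n -> nat -> R) (Phi : 'I_m -> nat -> R).
Hypothesis phi_gt0 : forall (i : 'I_n) (u : nat), (0 < u)%N -> 0 < phi i u.
Hypothesis phi_noninc : forall (i : 'I_n) (u v : nat),
  (0 < u)%N -> (u <= v)%N -> phi i v <= phi i u.
Hypothesis Phi_gt0 : forall (k : 'I_m) (u : nat), (0 < u)%N -> 0 < Phi k u.
Hypothesis Phi_nondec : forall (k : 'I_m) (u v : nat),
  (0 < u)%N -> (u <= v)%N -> Phi k u <= Phi k v.

Variables (D : nat -> 'I_m -> nat) (l : nat -> 'I_n -> nat).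
Hypothesis D_level : forall u k, (0 < u)%N ->
  Phi k u < t ^+ D u k /\ ((0 < D u k)%N -> t ^+ (D u k).-1 <= Phi k u).
Hypothesis l_level : forall u i, (0 < u)%N ->
  (t ^+ (l u i).+1)^-1 < phi i u /\ ((0 < l u i)%N -> phi i u <= (t ^+ l u i)^-1).

Lemma W_setP (A : MX) : W_set phi Phi A <-> lunit_mx A /\
  forall a, exists2 b, (a <= b)%N & (0 < b)%N /\ solvable (D b) (l b) A.
Proof.
have E b : (0 < b)%N -> (exists q : Q, [/\ q != 0,
    forall i, dist_poly ((map_mx (@lpoly R F) q *m col i A) 0 0) < phi i b &
    forall k, lnorm (@lpoly R F (q 0 k)) <= Phi k b]) <-> solvable (D b) (l b) A.
  move=> b0; split => -[q [q0 ha hb]]; exists q; split => //.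
  - move=> k; have [h1 h2] := D_level k b0.
    by apply/(lnorm_lpoly_leP _ (Phi_gt0 k b0) h1 h2).
  - move=> i; have [h1 h2] := l_level i b0.
    exact/(dist_poly_ltP _ h1 h2)/ha.
  - move=> i; have [h1 h2] := l_level i b0.
    by apply/(dist_poly_ltP _ h1 h2) => s; exact: hb.
  - move=> k; have [h1 h2] := D_level k b0.
    exact/(lnorm_lpoly_leP _ (Phi_gt0 k b0) h1 h2).
rewrite /W_set /=; split=> -[AI]; [move/infinite_natP => H|move=> H]; split=> //.
  by move=> a; have [b ab [b0 /(E _ b0) ?]] := H a; exists b.
apply/infinite_natP => a; have [b ab [b0 /(E _ b0) ?]] := H a.
by exists b.
Qed.

Lemma D_nondec u v k : (0 < u)%N -> (u <= v)%N -> (D u k <= D v k)%N.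
Proof.
move=> u0 uv; have v0 := leq_trans u0 uv.
have [_ h] := D_level k u0; have [h' _] := D_level k v0.
exact: degree_level_leW (Phi_nondec k u0 uv) h h'.
Qed.

Lemma l_nondec u v i : (0 < u)%N -> (u <= v)%N -> (l u i <= l v i)%N.
Proof.
move=> u0 uv; have v0 := leq_trans u0 uv.
have [_ h] := l_level i u0; have [h' _] := l_level i v0.
exact: digit_level_le (phi_noninc i u0 uv) h h'.
Qed.

Let Phi_prod u := \prod_k Phi k u.
Let phi_prod u := \prod_i phi i u.

Lemma Phi_prod_gt0 u : (0 < u)%N -> 0 < Phi_prod u.
Proof. by move=> u0; apply: prodr_gt0 => k _; exact: Phi_gt0. Qed.

Lemma phi_prod_gt0 u : (0 < u)%N -> 0 < phi_prod u.
Proof. by move=> u0; apply: prodr_gt0 => i _; exact: phi_gt0. Qed.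

Lemma Phi_prod_ge0 u : (0 < u)%N -> 0 <= Phi_prod u.
Proof. by move=> /Phi_prod_gt0/ltW. Qed.

Lemma phi_prod_ge0 u : (0 < u)%N -> 0 <= phi_prod u.
Proof. by move=> /phi_prod_gt0/ltW. Qed.

Lemma Phi_prod_nondec u v : (0 < u)%N -> (u <= v)%N -> Phi_prod u <= Phi_prod v.
Proof.
by move=> u0 uv; apply: ler_prod => k _; rewrite ltW ?Phi_gt0//= Phi_nondec.
Qed.

Lemma phi_prod_noninc u v : (0 < u)%N -> (u <= v)%N -> phi_prod v <= phi_prod u.
Proof.
move=> u0 uv; apply: ler_prod => i _.
by rewrite ltW ?phi_gt0 ?(leq_trans u0)//= phi_noninc.
Qed.

Lemma Phi_prod_le_boxes u : (0 < u)%N -> Phi_prod u <= t ^+ (\sum_k D u k).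
Proof.
move=> u0; rewrite -prodrXr; apply: ler_prod => k _; rewrite ltW ?Phi_gt0//=.
by have [/ltW] := D_level k u0.
Qed.

Lemma boxes_le_Phi_prod u : (0 < u)%N -> (forall k, 1 <= Phi k u) ->
  t ^+ (\sum_k D u k) <= t ^+ m * Phi_prod u.
Proof.
move=> u0 P1; rewrite -prodrXr -[m in t ^+ m]card_ord -prodr_const -big_split.
apply: ler_prod => k _; rewrite exprn_ge0 ?(ltW t0)//=.
have [h1 h2] := D_level k u0; case E : (D u k) h1 h2 => [|d] h1 h2.
  by move: h1; rewrite expr0 ltNge P1.
by rewrite exprS ler_pM2l//; exact: h2.
Qed.

Lemma phi_prod_le_digits u : (0 < u)%N -> (forall i, phi i u <= 1) ->
  phi_prod u <= (t ^+ (\sum_i l u i))^-1.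
Proof.
move=> u0 p1; rewrite -prodrXr -prodfV; apply: ler_prod => i _.
rewrite ltW ?phi_gt0//=.
have [h1 h2] := l_level i u0; case: (l u i) h2 => [|d] h2; last exact: h2.
by rewrite expr0 invr1.
Qed.

Lemma digits_le_phi_prod u : (0 < u)%N ->
  (t ^+ (\sum_i l u i))^-1 <= t ^+ n * phi_prod u.
Proof.
move=> u0; rewrite -prodrXr -prodfV -[n in t ^+ n]card_ord -prodr_const -big_split.
apply: ler_prod => i _; rewrite invr_ge0 exprn_ge0 ?(ltW t0)//=.
have [/ltW h1 _] := l_level i u0; rewrite -ler_pdivrMl//.
by rewrite -invfM -exprS.
Qed.

Let term r := r%:R^-1 * Phi_prod r * phi_prod r.

Lemma term_ge0 r : (0 < r)%N -> 0 <= term r.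
Proof. by move=> r0; rewrite !mulr_ge0 ?invr_ge0 ?Phi_prod_ge0 ?phi_prod_ge0 ?ler0n. Qed.

Lemma sum_term_le N N' : (N <= N')%N ->
  \sum_(1 <= r < N) term r <= \sum_(1 <= r < N') term r.
Proof.
have [N0 _|N0 NN'] := leqP N 1.
  by rewrite big_geq// big_nat_cond sumr_ge0// => r /andP[/andP[r0 _] _]; exact: term_ge0.
rewrite (big_cat_nat (n := N) _ NN') ?(ltnW N0)//= lerDl.
rewrite big_nat_cond sumr_ge0// => r /andP[/andP[r0 _] _]; apply: term_ge0.
by rewrite (leq_trans _ r0)// ltnW.
Qed.

(** On a block the monotone factors are compared with their end values, while
    the weights [1/r] add up to a constant when [v] is a fixed multiple of [u]. *)
Lemma block_le u v : (0 < u)%N -> (u <= v)%N ->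
  \sum_(u <= r < v) term r <= v%:R / u%:R * (Phi_prod v * phi_prod u).
Proof.
move=> u0 uv.
apply: (@le_trans _ _ (\sum_(u <= r < v) (u%:R^-1 * (Phi_prod v * phi_prod u)))).
  apply: ler_sum_nat => r /andP[ur rv]; rewrite /term -mulrA.
  have r0 := leq_trans u0 ur.
  apply: ler_pM; rewrite ?invr_ge0 ?mulr_ge0 ?Phi_prod_ge0 ?phi_prod_ge0//.
    by rewrite lef_pV2 ?posrE ?ltr0n// ler_nat.
  by apply: ler_pM; rewrite ?Phi_prod_ge0 ?phi_prod_ge0// ?Phi_prod_nondec ?phi_prod_noninc// ltnW.
rewrite sumr_const_nat -[leLHS]mulr_natl mulrA ler_wpM2r//.
  by rewrite mulr_ge0 ?Phi_prod_ge0 ?phi_prod_ge0// (leq_trans u0).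
by rewrite ler_wpM2r ?invr_ge0// ler_nat leq_subr.
Qed.

Lemma block_ge u v : (0 < u)%N -> (u <= v)%N ->
  (v - u)%:R / v%:R * (Phi_prod u * phi_prod v) <= \sum_(u <= r < v) term r.
Proof.
move=> u0 uv; have v0 := leq_trans u0 uv.
apply: (@le_trans _ _ (\sum_(u <= r < v) (v%:R^-1 * (Phi_prod u * phi_prod v)))).
  by rewrite sumr_const_nat -[leRHS]mulr_natl mulrA.
apply: ler_sum_nat => r /andP[ur rv]; rewrite /term -mulrA.
have r0 := leq_trans u0 ur.
apply: ler_pM; rewrite ?invr_ge0 ?mulr_ge0 ?Phi_prod_ge0 ?phi_prod_ge0//.
  by rewrite lef_pV2 ?posrE ?ltr0n// ler_nat ltnW.
by apply: ler_pM; rewrite ?Phi_prod_ge0 ?phi_prod_ge0// ?Phi_prod_nondec ?phi_prod_noninc// ltnW.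
Qed.

Hypothesis phi_cvg0 : forall i : 'I_n, phi i u @[u --> \oo] --> (0 : R).
Hypothesis Phi_cvgy : forall k : 'I_m, Phi k u @[u --> \oo] --> +oo.
Variables (N0 M : nat) (c1 c2 : R).
Hypotheses (M_gt1 : (1 < M)%N) (c1_gt1 : 1 < c1) (c2_gt1 : 1 < c2).
Hypothesis Phi_growth : forall (k : 'I_m) (j : nat), (N0 <= j)%N ->
  c1 * Phi k (M ^ j)%N <= Phi k (M ^ j.+1)%N /\
  Phi k (M ^ j.+1)%N <= c2 * Phi k (M ^ j)%N.

Let c2_ge0 : 0 <= c2 := ltW (lt_trans ltr01 c2_gt1).

Let M_gt0 : (0 < M)%N := ltnW M_gt1.

Lemma growth_iter k j s : (N0 <= j)%N ->
  c1 ^+ s * Phi k (M ^ j)%N <= Phi k (M ^ (j + s))%N <= c2 ^+ s * Phi k (M ^ j)%N.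
Proof.
move=> Nj; elim: s => [|s /andP[IH1 IH2]]; first by rewrite !expr0 !mul1r addn0 lexx.
have [h1 h2] := Phi_growth k (leq_trans Nj (leq_addr s j)).
rewrite addnS !exprS -!mulrA; apply/andP; split.
  by apply: le_trans h1; rewrite ler_pM2l// (lt_trans _ c1_gt1).
by apply: (le_trans h2); rewrite ler_pM2l// (lt_trans _ c2_gt1).
Qed.

Lemma Phi_prod_growth j s : (N0 <= j)%N ->
  Phi_prod (M ^ (j + s))%N <= (c2 ^+ s) ^+ m * Phi_prod (M ^ j)%N.
Proof.
move=> Nj; rewrite -[m in _ ^+ m]card_ord -prodr_const -big_split /=.
apply: ler_prod => k _; rewrite ltW ?Phi_gt0 ?expn_gt0 ?M_gt0//=.
by have /andP[] := growth_iter k s Nj.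
Qed.

Lemma eventually_normalized a0 : exists J, [/\ (N0 <= J)%N, (a0 <= M ^ J)%N &
  forall u, (M ^ J <= u)%N -> (forall k, 1 <= Phi k u) /\ (forall i, phi i u <= 1)].
Proof.
have /(filter_forall _)[Ja _ Ha] : forall k, \forall u \near \oo, 1 <= Phi k u.
  by move=> k; have /cvgryPge := Phi_cvgy k; apply.
have /(filter_forall _)[Jb _ Hb] : forall i, \forall u \near \oo, phi i u <= 1.
  by move=> i; apply: cvgr_le (phi_cvg0 i) _ _; exact: ltr01.
exists (N0 + (a0 + (Ja + Jb)))%N; rewrite leq_addr.
have h : ((N0 + (a0 + (Ja + Jb))) <= M ^ (N0 + (a0 + (Ja + Jb))))%N.
  by rewrite ltnW// ltn_expl.
split=> //; first by apply: leq_trans h; lia.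
by move=> u hu; split; [apply: Ha|apply: Hb] => /=; lia.
Qed.

Variable mu : {measure set (lmx_borel R F m n) -> \bar R}.
Hypothesis mu_haar : haar_measure mu.
Hypothesis mu_unit : mu (@lunit_mx R F m n) = 1%E.
Hypotheses (n_gt0 : (0 < n)%N) (m_gt0 : (0 < m)%N).
Local Notation prob := (prob mu).

Lemma borel_unsolvable_from a0 : borel [set A : MX | forall b, (a0 <= b)%N -> (0 < b)%N ->
  ~ solvable (D b) (l b) A].
Proof.
apply: borel_all => b; do 2! apply: borel_imp; apply: borel_not.
exact: borel_solvable.
Qed.

(** The stages are [u_i = M^(J + s i)]. If the conclusion fails, the hitting
    probabilities [p] have bounded sums, although they dominate the blocks of
    the series up to a constant. *)
Lemma prob_unsolvable_from a0 (w : nat) :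
  (forall B, exists N, B < \sum_(1 <= r < N) term r) ->
  prob [set A | forall b, (a0 <= b)%N -> (0 < b)%N -> ~ solvable (D b) (l b) A]
    <= 2 / t ^+ w.
Proof.
move=> div; rewrite leNgt; apply/negP => big.
have [J [NJ aJ norm]] := eventually_normalized a0.
(* Over s steps every degree bound increases by at least w + 1. *)
have [s cs] : exists s, t ^+ w.+1 <= c1 ^+ s.
  have c10 : 0 < c1 - 1 by rewrite subr_gt0.
  exists (Num.bound (t ^+ w.+1 / (c1 - 1))).
  have := archi_boundP (divr_ge0 (exprn_ge0 w.+1 (ltW t0)) (ltW c10)).
  set b := Num.bound _; rewrite ltr_pdivrMr// => /ltW/le_trans; apply.
  elim: b => [|b IH]; first by rewrite mul0r expr0.
  rewrite -natr1 mulrDl mul1r exprS.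
  have : 1 <= c1 ^+ b by rewrite exprn_ege1// ltW.
  by move: IH c10; nra.
pose uu i := (M ^ (J + s * i))%N.
have uu0 i : (0 < uu i)%N by rewrite expn_gt0 M_gt0.
have Juu i : (M ^ J <= uu i)%N by rewrite leq_exp2l// leq_addr.
have uuS i : uu i.+1 = (M ^ ((J + s * i) + s))%N by rewrite /uu mulnS; congr (_ ^ _)%N; lia.
have NJi i : (N0 <= J + s * i)%N by rewrite (leq_trans NJ)// leq_addr.
have uu_le i : (uu i <= uu i.+1)%N by rewrite uuS leq_exp2l// leq_addr.
pose k0 : 'I_m := Ordinal m_gt0.
have Dgrow i k : (widen k0 (D (uu i)) w.+1 k <= D (uu i.+1) k)%N.
  apply: (@leq_trans (D (uu i) k + w.+1)).
    by rewrite /widen; case: ifP => _; rewrite ?leq_add2l.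
  have [h1 h2] := D_level k (uu0 i); have [h3 _] := D_level k (uu0 i.+1).
  have Dpos : (0 < D (uu i) k)%N.
    rewrite lt0n; apply/eqP => E; move: h1; rewrite E expr0 ltNge.
    by have [-> _] := norm _ (Juu i).
  apply: degree_level_le Dpos (h2 Dpos) h3.
  have /andP[+ _] := growth_iter k s (NJi i); rewrite -uuS; apply: le_trans.
  by rewrite ler_wpM2r// ltW ?Phi_gt0.
have lmono j i : (l (uu j) i <= l (uu j.+1) i)%N by exact: l_nondec.
pose p j := (t ^+ (\sum_i l (uu j.+1) i - (\sum_k D (uu j) k + w)))^-1.
have p0 j : 0 <= p j by rewrite invr_ge0 exprn_ge0// ltW.
have psum N : \sum_(j < N) p j <= t ^+ w.
  have [H|//] := prob_never_solvable mu_haar mu_unit n_gt0 N Dgrow lmono.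
  move: big; rewrite ltNge => /negP; case; apply: le_trans H.
  apply: prob_le => //; first exact: borel_unsolvable_from.
    apply: borel_all => j; apply: borel_imp; apply: borel_not.
    exact: borel_solvable.
  by move=> A H j jN; apply: H => //; rewrite (leq_trans aJ).
(* Since p tends to 0, the subtraction of natural numbers in its exponent is
   eventually not truncated. *)
have [i1 hi1] : exists i1, forall j, (i1 <= j)%N -> p j < 1.
  have : p @ \oo --> 0.
    apply: cvg_series_cvg_0; apply: nondecreasing_is_cvgn.
      by apply/nondecreasing_seqP => N; rewrite seriesSr lerDl p0.
    by exists (t ^+ w) => _ [N _ <-]; rewrite seriesEord; exact: psum.
  by move=> /cvgr_lt /(_ 1 ltr01)[i1 _ H]; exists i1.
pose h j := Phi_prod (uu j) * phi_prod (uu j.+1).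
have hp j : (i1 <= j)%N -> h j <= p j.
  move=> /hi1; rewrite /p.
  case: (leqP (\sum_i l (uu j.+1) i) (\sum_k D (uu j) k + w)) => [/eqP ->|/ltnW E _].
    by rewrite expr0 invr1 ltxx.
  set e := (\sum_k _ + w)%N in E *.
  have -> : (t ^+ (\sum_i l (uu j.+1) i - e))^-1 =
      t ^+ e / t ^+ (\sum_i l (uu j.+1) i).
    rewrite -{2}(subnK E) exprD invfM mulrCA divff ?mulr1//.
    by rewrite expf_neq0// gt_eqF.
  apply: ler_pM; rewrite ?Phi_prod_ge0 ?phi_prod_ge0//.
    by rewrite (le_trans (Phi_prod_le_boxes (uu0 j)))// ler_weXn2l ?ltW// leq_addr.
  by apply: phi_prod_le_digits => //; have [_] := norm _ (Juu j.+1).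
(* u_(i+2) / u_(i+1) = M^s, and from u_i to u_(i+2) the product of the Phi_k
   grows by at most c2^(2sm). *)
pose K := (M ^ s)%:R * ((c2 ^+ (s + s)) ^+ m).
have K0 : 0 <= K.
  by rewrite mulr_ge0 ?ler0n// exprn_ge0// exprn_ge0.
have blk j : \sum_(uu j.+1 <= r < uu j.+2) term r <= K * h j.
  apply: le_trans (block_le (uu0 _) (uu_le _)) _.
  rewrite /K -[leRHS]mulrA; apply: ler_pM.
  - by rewrite divr_ge0.
  - by rewrite mulr_ge0 ?Phi_prod_ge0 ?phi_prod_ge0.
  - rewrite [uu j.+2]uuS expnD natrM mulrAC divff ?mul1r//.
    by rewrite pnatr_eq0 -lt0n expn_gt0 M_gt0.
  - rewrite /h mulrA ler_wpM2r ?phi_prod_ge0//.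
    have := Phi_prod_growth (s + s) (NJi j); congr (Phi_prod _ <= _).
    by rewrite uuS /uu mulnS; congr (_ ^ _)%N; lia.
have tot N : \sum_(1 <= r < uu (i1 + N).+1) term r <=
    \sum_(1 <= r < uu i1.+1) term r + K * \sum_(j < (i1 + N)) p j.
  elim: N => [|N IH].
    by rewrite addn0 lerDl mulr_ge0// sumr_ge0.
  rewrite addnS (big_cat_nat (n := uu (i1 + N).+1))//= big_ord_recr /= mulrDr addrA.
  apply: lerD => //; apply: le_trans (blk _) _.
  by rewrite ler_wpM2l// hp// leq_addr.
have [N] := div (\sum_(1 <= r < uu i1.+1) term r + K * t ^+ w).
apply/negP; rewrite -leNgt.
have [s0|s0] := posnP s.
  by have := exprn_egt1 w.+1 t1; rewrite ltNge (le_trans cs)// s0 expr0.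
have NN : (N <= uu (i1 + N).+1)%N.
  rewrite (@leq_trans (J + s * (i1 + N).+1))//; last by rewrite ltnW// ltn_expl.
  by nia.
apply: le_trans (sum_term_le NN) _; apply: le_trans (tot N) _.
by rewrite lerD2l ler_wpM2l.
Qed.

Lemma borel_W : borel [set A : MX | forall a, exists2 b, (a <= b)%N &
  (0 < b)%N /\ solvable (D b) (l b) A].
Proof.
apply: borel_all => a0.
rewrite (_ : (fun A => _) = [set A | exists b, ((a0 <= b)%N /\ (0 < b)%N) /\
    solvable (D b) (l b) A]); last first.
  by apply/seteqP; split => A /= => [[b ? []]|[b [[]]]]; exists b.
apply: borel_ex => b.
by apply: borel_and; [exact: borel_cst|exact: borel_solvable].
Qed.

Lemma W_setE : W_set phi Phi = [set A : MX | forall a, exists2 b, (a <= b)%N &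
  (0 < b)%N /\ solvable (D b) (l b) A] `&` @lunit_mx R F m n.
Proof. by apply/seteqP; split => A; [move=> /W_setP[]|move=> [? ?]; apply/W_setP]. Qed.

Lemma mu_W_divergent : (forall B, exists N, B < \sum_(1 <= r < N) term r) ->
  mu (W_set phi Phi) = 1%E.
Proof.
move=> div; rewrite W_setE (probE mu_unit borel_W); congr EFin.
apply/eqP; rewrite eq_le (prob_le1 mu_unit borel_W)/=.
have := prob_split mu_unit (measurableT : borel setT) borel_W.
rewrite (probT mu_unit) => ->.
have -> : prob [set A | setT A /\ ~ (forall a, exists2 b, (a <= b)%N &
    (0 < b)%N /\ solvable (D b) (l b) A)] = 0.
  pose G a0 : set MX := [set A | forall b, (a0 <= b)%N -> (0 < b)%N ->
    ~ solvable (D b) (l b) A].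
  have G0 a0 : prob (G a0) = 0.
    apply/eqP; rewrite eq_le prob_ge0 andbT leNgt; apply/negP => G0.
    have [w hw] := expr_unbounded F (2 / prob (G a0)).
    have := prob_unsolvable_from a0 w div; rewrite leNgt => /negP; apply.
    by rewrite ltr_pdivrMr ?exprn_gt0// mulrC -ltr_pdivrMr.
  rewrite (_ : [set A | _] = \bigcup_a0 G a0).
    have /negligibleP/= : mu.-negligible (\bigcup_a0 (G a0 `&` @lunit_mx R F m n)).
      apply: negligible_bigcup => a0; apply/negligibleP.
        by apply: borel_and; [exact: borel_unsolvable_from|exact: borel_lunit].
      by have := probE mu_unit (borel_unsolvable_from a0); rewrite -/(G a0) G0.
    rewrite -setI_bigcupl /prob => -> //.
    apply: borel_and; last exact: borel_lunit.
    by apply: bigcupT_measurable => a0; exact: borel_unsolvable_from.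
  apply/seteqP; split => A /=.
    move=> [_ /existsNP[a0 H]]; exists a0 => // b ab b0 sb.
    by apply: H; exists b.
  move=> [a0 _ H]; split => // /(_ a0)[b ab [b0 sb]]; exact: (H b).
rewrite addr0; apply: prob_le => //.
- by apply: borel_and; [exact: measurableT|exact: borel_W].
- exact: borel_W.
- by move=> A [].
Qed.

(** For [v_(j+1) <= u < v_(j+2)] the solutions at [u] are among those with the
    degrees of [v_(j+2)] and the digits of [v_(j+1)]; their probability is at
    most a constant times the block of the series from [v_j] to [v_(j+1)]. *)
Lemma mu_W_convergent B : (forall N, \sum_(1 <= r < N) term r <= B) ->
  mu (W_set phi Phi) = 0%E.
Proof.
move=> bnd; rewrite W_setE.
have [J [NJ _ norm]] := eventually_normalized 0.
pose v j := (M ^ (J + j))%N.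
have v0 j : (0 < v j)%N by rewrite expn_gt0 M_gt0.
have Jv j : (M ^ J <= v j)%N by rewrite leq_exp2l// leq_addr.
have v_le j : (v j <= v j.+1)%N by rewrite leq_exp2l// addnS.
pose G j : set MX := [set A | solvable (D (v j.+2)) (l (v j.+1)) A].
have mG j : borel (G j) by exact: borel_solvable.
have mGI j : borel (G j `&` @lunit_mx R F m n).
  by apply: borel_and => //; exact: borel_lunit.
pose K := t ^+ m * (t ^+ n * ((c2 ^+ 2) ^+ m)).
have K0 : 0 <= K.
  by rewrite !mulr_ge0 ?exprn_ge0 ?(ltW t0).
have G_le j : prob (G j) <= K * 2 * \sum_(v j <= r < v j.+1) term r.
  apply: le_trans (prob_solvable mu_haar mu_unit n_gt0 _ _) _.
  apply: (@le_trans _ _ ((t ^+ m * Phi_prod (v j.+2)) * (t ^+ n * phi_prod (v j.+1)))).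
    apply: ler_pM; rewrite ?invr_ge0 ?exprn_ge0 ?(ltW t0)//.
      by apply: boxes_le_Phi_prod => //; have [] := norm _ (Jv j.+2).
    exact: digits_le_phi_prod.
  apply: (@le_trans _ _ (K * (Phi_prod (v j) * phi_prod (v j.+1)))).
    rewrite /K -!mulrA ler_wpM2l ?exprn_ge0 ?(ltW t0)//.
    rewrite mulrCA ler_wpM2l ?exprn_ge0 ?(ltW t0)//.
    rewrite mulrA ler_wpM2r ?phi_prod_ge0//.
    have := Phi_prod_growth 2 (leq_trans NJ (leq_addr j J)); congr (Phi_prod _ <= _).
    by rewrite /v; congr (_ ^ _)%N; lia.
  rewrite -mulrA ler_wpM2l// -ler_pdivrMl//.
  apply: le_trans (block_ge (v0 j) (v_le j)); rewrite ler_wpM2r//.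
    by rewrite mulr_ge0 ?Phi_prod_ge0 ?phi_prod_ge0.
  rewrite ler_pdivlMr ?ltr0n// mulrC ler_pdivrMr ?ltr0n// -natrM ler_nat.
  have -> : v j.+1 = (M * v j)%N by rewrite /v addnS expnS.
  by have := v0 j; move: (v j) M_gt1 => x; nia.
have H : mu (lim_sup_set (fun j => G j `&` @lunit_mx R F m n)) = 0%E.
  apply: lim_sup_set_cvg0 => //.
  apply: (@le_lt_trans _ _ (K * 2 * B)%:E); last by rewrite ltry.
  apply: lime_le; first by apply: is_cvg_nneseries => j _ _; exact: measure_ge0.
  apply: nearW => N; rewrite big_mkord.
  rewrite (eq_bigr (fun j => (prob (G (nat_of_ord j)))%:E)); last first.
    by move=> j _; exact: probE.
  rewrite sumEFin lee_fin.
  apply: (@le_trans _ _ (\sum_(j < N) K * 2 * \sum_(v j <= r < v j.+1) term r)).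
    by apply: ler_sum => j _; exact: G_le.
  rewrite -mulr_sumr ler_wpM2l ?(mulr_ge0 K0)//; apply: le_trans (bnd (v N)).
  suff : \sum_(1 <= r < v 0%N) term r + \sum_(j < N) \sum_(v j <= r < v j.+1) term r =
      \sum_(1 <= r < v N) term r.
    move=> <-; rewrite lerDr big_nat_cond sumr_ge0// => r /andP[/andP[r0 _] _].
    exact: term_ge0.
  elim: N => [|N IH]; first by rewrite big_ord0 addr0.
  by rewrite big_ord_recr /= addrA IH -big_cat_nat.
apply/eqP; rewrite eq_le measure_ge0 andbT -H; apply: le_measure; rewrite ?inE.
- by apply: borel_and; [exact: borel_W|exact: borel_lunit].
- apply: bigcapT_measurable => j; apply: bigcup_measurable => i _; exact: mGI.
move=> A [WA AI] j _; have [b jb [b0 sb]] := WA (v j.+1).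
have Mb := trunc_log_bounds M_gt1 b0.
move/andP: Mb => [Mb1 Mb2].
have Jl : (J + j.+1 <= trunc_log M b)%N by apply: trunc_log_max.
have E : trunc_log M b = (J + (trunc_log M b - J - 1).+1)%N by lia.
exists (trunc_log M b - J - 1)%N; first by rewrite /=; lia.
split=> //; apply: solvable_le sb => [k|i].
  by apply: D_nondec => //; rewrite /v addnS -E ltnW.
by apply: l_nondec => //; rewrite /v -E.
Qed.

End Thresholds.

(** * The zero-one criterion *)

Theorem theorem13 (R : realType) (F : finFieldType) (n m : nat)
    (n_gt0 : (0 < n)%N) (m_gt0 : (0 < m)%N)
    (mu : {measure set (lmx_borel R F m n) -> \bar R})
    (mu_haar : haar_measure mu)
    (mu_unit : mu (@lunit_mx R F m n) = 1%E)
    (phi : 'I_n -> nat -> R) (Phi : 'I_m -> nat -> R)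
    (phi_gt0 : forall (i : 'I_n) (u : nat), (0 < u)%N -> 0 < phi i u)
    (phi_noninc : forall (i : 'I_n) (u v : nat),
      (0 < u)%N -> (u <= v)%N -> phi i v <= phi i u)
    (phi_cvg0 : forall i : 'I_n, phi i u @[u --> \oo] --> (0 : R))
    (Phi_gt0 : forall (k : 'I_m) (u : nat), (0 < u)%N -> 0 < Phi k u)
    (Phi_nondec : forall (k : 'I_m) (u v : nat),
      (0 < u)%N -> (u <= v)%N -> Phi k u <= Phi k v)
    (Phi_cvgy : forall k : 'I_m, Phi k u @[u --> \oo] --> +oo)
    (N0 M : nat) (N0_gt1 : (1 < N0)%N) (M_gt1 : (1 < M)%N)
    (c1 c2 : R) (c1_gt1 : 1 < c1) (c2_gt1 : 1 < c2)
    (Phi_growth : forall (k : 'I_m) (j : nat), (N0 <= j)%N ->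
      c1 * Phi k (M ^ j)%N <= Phi k (M ^ j.+1)%N /\
      Phi k (M ^ j.+1)%N <= c2 * Phi k (M ^ j)%N) :
  ((\sum_(1 <= r <oo)
      (r%:R^-1 * (\prod_(k < m) Phi k r) * \prod_(i < n) phi i r)%:E < +oo)%E ->
    mu (@W_set R F m n phi Phi) = 0%E) /\
  ((\sum_(1 <= r <oo)
      (r%:R^-1 * (\prod_(k < m) Phi k r) * \prod_(i < n) phi i r)%:E = +oo)%E ->
    mu (@W_set R F m n phi Phi) = 1%E).
Proof.
have [D D_level] : exists D : nat -> 'I_m -> nat, forall u k, (0 < u)%N ->
    Phi k u < (#|F|%:R : R) ^+ D u k /\
    ((0 < D u k)%N -> (#|F|%:R : R) ^+ (D u k).-1 <= Phi k u).
  have H (uk : nat * 'I_m) : exists d : nat, (0 < uk.1)%N ->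
      Phi uk.2 uk.1 < (#|F|%:R : R) ^+ d /\
      ((0 < d)%N -> (#|F|%:R : R) ^+ d.-1 <= Phi uk.2 uk.1).
    have [->|u0] := posnP uk.1; first by exists 0%N.
    by have [d ?] := degree_level F (Phi_gt0 uk.2 _ u0); exists d.
  by have [D HD] := choice H; exists (fun u k => D (u, k)) => u k; exact: HD (u, k).
have [l l_level] : exists l : nat -> 'I_n -> nat, forall u i, (0 < u)%N ->
    ((#|F|%:R : R) ^+ (l u i).+1)^-1 < phi i u /\
    ((0 < l u i)%N -> phi i u <= ((#|F|%:R : R) ^+ l u i)^-1).
  have H (ui : nat * 'I_n) : exists d : nat, (0 < ui.1)%N ->
      ((#|F|%:R : R) ^+ d.+1)^-1 < phi ui.2 ui.1 /\
      ((0 < d)%N -> phi ui.2 ui.1 <= ((#|F|%:R : R) ^+ d)^-1).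
    have [->|u0] := posnP ui.1; first by exists 0%N.
    by have [d ?] := digit_level F (phi_gt0 ui.2 _ u0); exists d.
  by have [l Hl] := choice H; exists (fun u i => l (u, i)) => u i; exact: Hl (u, i).
have summand_ge0 r : (1 <= r)%N -> true -> (0 <= (r%:R^-1 *
    (\prod_(k < m) Phi k r) * \prod_(i < n) phi i r)%:E :> \bar R)%E.
  by move=> r0 _; rewrite lee_fin; exact: term_ge0.
split=> [conv|div].
  apply: (mu_W_convergent phi_gt0 phi_noninc Phi_gt0 Phi_nondec D_level l_level
    phi_cvg0 Phi_cvgy M_gt1 c1_gt1 c2_gt1 Phi_growth mu_haar mu_unit n_gt0 m_gt0
    (B := fine (\sum_(1 <= r <oo) (r%:R^-1 * (\prod_(k < m) Phi k r) *
      \prod_(i < n) phi i r)%:E)%E)) => N.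
  rewrite -lee_fin fineK; last first.
    by rewrite ge0_fin_numE//; apply: nneseries_ge0.
  by rewrite -sumEFin; exact: nneseries_lim_ge.
apply: (mu_W_divergent phi_gt0 phi_noninc Phi_gt0 Phi_nondec D_level l_level
  phi_cvg0 Phi_cvgy M_gt1 c1_gt1 c2_gt1 Phi_growth mu_haar mu_unit n_gt0 m_gt0).
move=> B; apply: contrapT => bounded.
suff : (+oo <= B%:E :> \bar R)%E by rewrite leye_eq.
rewrite -div; apply: lime_le; first exact: is_cvg_nneseries.
apply: nearW => N; rewrite sumEFin lee_fin leNgt; apply/negP => BN.
by apply: bounded; exists N.
Qed.
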